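(* Let $f\in C^1(\mathbb{R})$, let $u_L,u_R\in\mathbb{R}$, and let $u$ be the entropy solution of $\partial_t u+\partial_x f(u)=0$ with initial data $u_0(x)=u_L$ for $x<0$ and $u_0(x)=u_R$ for $x>0$. Fix $c\in\mathbb{R}$ and let $a_c(x,t)=A(u(x,t),c)$, where $A(v,c)=\frac{f(v)-f(c)}{v-c}$ if $v\neq c$ and $A(c,c)=f'(c)$. Then the (Filippov) solution of the ODE $$\dot x_t=a_c(x_t,t)\ \text{ for } t>0,\qquad x_0=0,$$ is the straight line $x_t=Vt$, where the velocity $V=V(u_L,u_R)$ is given by $$V(u_L,u_R)=\begin{cases} \min_{v\in[u_L,u_R]}\frac{f(v)-f(c)}{v-c} & \text{if } c<u_L\leq u_R,\\ \max_{v\in[u_R,u_L]}\frac{f(v)-f(c)}{v-c} & \text{if } c<u_R\leq u_L,\\ (f_\smile)'(c) & \text{if } u_L\leq c\leq u_R,\\ (f_\frown)'(c) & \text{if } u_R\leq c\leq u_L,\\ \max_{v\in[u_L,u_R]}\frac{f(v)-f(c)}{v-c} & \text{if } u_L\leq u_R<c,\\ \min_{v\in[u_R,u_L]}\frac{f(v)-f(c)}{v-c} & \text{if } u_R\leq u_L<c, \end{cases}$$ where $f_\smile$ and $f_\frown$ are the convex and concave envelopes of $f$ between $u_L$ and $u_R$.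
   Context: $\mathbb{R}_+=[0,\infty)$. Envelopes: on the closed interval $I$ with endpoints $u_L,u_R$, $f_\smile(v)=\max\{h(v): h \text{ convex and } h\leq f \text{ on } I\}$ and $f_\frown(v)=\min\{h(v): h\text{ concave and } h\geq f\text{ on } I\}$ for $v\in I$. For $f\in C^1$ these are $C^1$ on $I$ when $I$ is nondegenerate, with derivatives at the endpoints of $I$ understood as one-sided derivatives. In the degenerate case $u_L=u_R=c$, both $(f_\smile)'(c)$ and $(f_\frown)'(c)$ are understood as $f'(c)$. Weak solution of $\partial_t u+\partial_x f(u)=0$, $u(0)=u_0$: $u\in L^\infty(\mathbb{R}\times\mathbb{R}_+)$ with $\int_{\mathbb{R}_+}\int_{\mathbb{R}} u\,\partial_t\varphi+f(u)\,\partial_x\varphi\,dx\,dt+\int_{\mathbb{R}} u_0(x)\varphi(x,0)\,dx=0$ for all $\varphi\in C_c^\infty(\mathbb{R}\times\mathbb{R}_+)$. Entropy pair: $(\eta,q)$ with $\eta:\mathbb{R}\to\mathbb{R}$ convex and $q'=\eta' f'$ (a.e., $q$ locally Lipschitz). Entropy solution: a weak solution $u$ such that $\int_{\mathbb{R}_+}\int_{\mathbb{R}}\eta(u)\partial_t\varphi+q(u)\partial_x\varphi\,dx\,dt+\int_{\mathbb{R}}\eta(u_0(x))\varphi(x,0)\,dx\geq 0$ for all $0\leq\varphi\in C_c^\infty(\mathbb{R}\times\mathbb{R}_+)$ and all entropy pairs $(\eta,q)$. By Kruzkhov, it exists and is unique for $u_0\in L^\infty(\mathbb{R})$. Filippov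 solution: for measurable $a=a(x,t)$, put $\underline a(x,t)=\lim_{\delta\downarrow0}\operatorname{ess\,inf}_{y\in(x-\delta,x+\delta)}a(y,t)$ and $\overline a(x,t)=\lim_{\delta\downarrow0}\operatorname{ess\,sup}_{y\in(x-\delta,x+\delta)}a(y,t)$. A Filippov solution of $\dot x_t=a(x_t,t)$, $t>s$, $x_s=x$, is an absolutely continuous $t\mapsto x_t$ on $[s,\infty)$ with $x_s=x$ and $\underline a(x_t,t)\leq\dot x_t\leq\overline a(x_t,t)$ for a.e. $t>s$. ''The solution'' means that $x_t=Vt$ is the unique Filippov solution starting at $(0,0)$. *)

(* Defs.v *)
From HB Require Import structures.
From mathcomp Require Export all_boot all_order all_algebra.
From mathcomp Require Export all_classical all_reals all_analysis.
From mathcomp Require Export ess_sup_inf.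

Set Implicit Arguments.
Unset Strict Implicit.
Unset Printing Implicit Defensive.

Import Order.TTheory GRing.Theory Num.Theory.
Import numFieldNormedType.Exports.

Local Open Scope classical_set_scope.
Local Open Scope ring_scope.

Section defs.
Context {R : realType}.

Local Notation mu := (@lebesgue_measure R).

Definition C1 (f : R -> R) : Prop :=
  (forall v, derivable f v 1) /\ continuous (derive1 f).

Definition ess_bounded (u : R * R -> R) : Prop :=
  measurable_fun
    (setT `*` `[0, +oo[%classic : set (measurableTypeR R * measurableTypeR R)) u /\
  exists M : R, {ae (mu \x mu)%E, forall p, 0 <= p.2 -> `|u p| <= M}.

Definition dx (phi : R * R -> R) : R * R -> R := 'D_((1, 0) : R * R) phi.
Definition dt (phi : R * R -> R) : R * R -> R := 'D_((0, 1) : R * R) phi.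

Fixpoint Cn (n : nat) (phi : R * R -> R) : Prop :=
  match n with
  | 0%N => continuous phi
  | m.+1 => [/\ continuous phi,
      forall p, derivable phi p (1, 0) /\ derivable phi p (0, 1),
      Cn m (dx phi) & Cn m (dt phi)]
  end.

(* Elements of C_c^oo(R x R_+) are represented by elements of C_c^oo(R^2), of
   which only the restriction to R x [0, +oo[ is used below; in particular they
   need not vanish at t = 0. *)
Definition test_function (phi : R * R -> R) : Prop :=
  (forall n, Cn n phi) /\ compact (closure [set p | phi p != 0]).

Definition weak_form (g h : R -> R) (u0 : R -> R) (u phi : R * R -> R) : R :=
  \int[mu]_(t in `[0, +oo[) (\int[mu]_(x in setT)
     (g (u (x, t)) * dt phi (x, t) + h (u (x, t)) * dx phi (x, t)))
  + \int[mu]_(x in setT) (g (u0 x) * phi (x, 0)).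

Definition weak_solution (f u0 : R -> R) (u : R * R -> R) : Prop :=
  ess_bounded u /\
  forall phi, test_function phi -> weak_form id f u0 u phi = 0.

Definition locally_lipschitz (q : R -> R) : Prop :=
  forall r : R, [lipschitz q x | x in `[- r, r]%classic].

Definition entropy_pair (f eta q : R -> R) : Prop :=
  [/\ convex_function (setT : set R) eta,
      locally_lipschitz q &
      {ae mu, forall v, derivable eta v 1 /\
                        is_derive v 1 q (derive1 eta v * derive1 f v)}].

Definition entropy_solution (f u0 : R -> R) (u : R * R -> R) : Prop :=
  weak_solution f u0 u /\
  forall eta q phi, entropy_pair f eta q -> test_function phi ->
    (forall x t, 0 <= t -> 0 <= phi (x, t)) ->
    0 <= weak_form eta q u0 u phi.

Definition ess_inf_ball (a : R * R -> R) (x t delta : R) : \bar R :=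
  ess_inf (mrestr mu (measurable_itv `]x - delta, x + delta[))
    (fun y => (a (y, t))%:E).

Definition ess_sup_ball (a : R * R -> R) (x t delta : R) : \bar R :=
  ess_sup (mrestr mu (measurable_itv `]x - delta, x + delta[))
    (fun y => (a (y, t))%:E).

Definition lower_env (a : R * R -> R) (x t : R) : \bar R :=
  lim (ess_inf_ball a x t delta @[delta --> 0^'+]).

Definition upper_env (a : R * R -> R) (x t : R) : \bar R :=
  lim (ess_sup_ball a x t delta @[delta --> 0^'+]).

Definition abs_continuous (a b : R) (x : R -> R) : Prop :=
  forall e : R, 0 < e -> exists2 d : R, 0 < d &
    forall (n : nat) (s r : 'I_n -> R),
      (forall i, a <= s i /\ s i <= r i /\ r i <= b) ->
      trivIset setT (fun i => `]s i, r i[%classic) ->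
      \sum_(i < n) (r i - s i) < d ->
      \sum_(i < n) `|x (r i) - x (s i)| < e.

(* Absolute continuity on [s, +oo[ is meant on compact subintervals; the values
   of [x] on ]-oo, s[ are irrelevant. *)
Definition filippov_solution (a : R * R -> R) (s x0 : R) (x : R -> R) : Prop :=
  [/\ forall T, abs_continuous s T x,
      x s = x0 &
      {ae mu, forall t, s < t -> derivable x t 1 /\
        (lower_env a (x t) t <= (derive1 x t)%:E <= upper_env a (x t) t)%E}].

Definition secant (f : R -> R) (v c : R) : R :=
  if v == c then derive1 f c else (f v - f c) / (v - c).

Definition is_min (A : set R) (m : R) : Prop := A m /\ lbound A m.
Definition is_max (A : set R) (m : R) : Prop := A m /\ ubound A m.

Definition is_convex_envelope (f : R -> R) (a b : R) (g : R -> R) : Prop :=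
  forall v, v \in `[a, b] ->
    is_max [set h v | h in [set h : R -> R |
      convex_function (`[a, b]%classic : set R) h /\
      forall w, w \in `[a, b] -> h w <= f w]] (g v).

Definition is_concave_envelope (f : R -> R) (a b : R) (g : R -> R) : Prop :=
  forall v, v \in `[a, b] ->
    is_min [set h v | h in [set h : R -> R |
      convex_function (`[a, b]%classic : set R) (fun w => - h w) /\
      forall w, w \in `[a, b] -> f w <= h w]] (g v).

(* [l] is the derivative at [c] of the envelope [g] of [f] on [a, b]: one-sided
   if [c] is an endpoint, and by convention the derivative of [f] if a = b. *)
Definition is_envelope_derive (f g : R -> R) (a b c l : R) : Prop :=
  if a == b then l = derive1 f c
  else (g w - g c) / (w - c) @[w --> within `[a, b]%classic c^'] --> l.

(* The cases overlap only when uL = uR; every (uL, uR, c) is in some case. *)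
Definition is_velocity (f : R -> R) (c uL uR V : R) : Prop :=
  let slopes a b :=
    [set (f v - f c) / (v - c) | v in `[a, b]%classic] in
  [/\ c < uL -> uL <= uR -> is_min (slopes uL uR) V,
      c < uR -> uR <= uL -> is_max (slopes uR uL) V,
      uL <= c -> c <= uR -> exists2 g, is_convex_envelope f uL uR g &
                                       is_envelope_derive f g uL uR c V,
      uR <= c -> c <= uL -> exists2 g, is_concave_envelope f uR uL g &
                                       is_envelope_derive f g uR uL c V &
      (uL <= uR -> uR < c -> is_max (slopes uL uR) V) /\
      (uR <= uL -> uL < c -> is_min (slopes uR uL) V)].

End defs.

(* Main.v *)
(** Comparing [u] with a constant [k] through the entropies [(u - k)^+] and
    [(k - u)^+] on cones [x > s t] and [x < s t] needs no doubling of variables.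
    For [uL <= uR], if [k] minimizes [f v - s v] over [[uL, uR]], it yields [u >= k]
    for [x > s t] and [u <= k] for [x < s t].  Letting [s] run through the rationals,
    [u(x, t)] minimizes [f v - (x / t) v] for almost every [(x, t)].  This inequality,
    tested at [v = c] or at the extremal [v] defining [V], shows that for [xi > V]
    there is [kap > 0] with [a_c <= x / t - kap] on [x > xi t], and symmetrically
    for [xi < V].  Hence the ray [x = V t] is a Filippov solution, and a solution
    leaving it would have [x / t] unbounded as [t] tends to 0.  The case [uR < uL]
    reduces to this one by replacing [u] and [f v] with [- u] and [- f (- v)]. *)
Require Import Defs.
From mathcomp Require Import lra ring measurable_realfun.
Set Implicit Arguments.
Unset Strict Implicit.
Unset Printing Implicit Defensive.
Import Order.TTheory GRing.Theory Num.Theory.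
Import numFieldNormedType.Exports.
Local Open Scope classical_set_scope.
Local Open Scope ring_scope.

(** Minimality of [k] is assumed only against values between the two data, so [u] must first be
    confined there. This maximum principle is the same comparison, with [s] a Lipschitz constant, so
    that the condition on [k] holds by itself, and with the vertex of the cone sent to infinity.

    Each comparison holds off a null set depending on [s] and [k], which is why only rational slopes
    are used. They determine [u] except on the rays where the monotone choice of minimizers jumps
    across a rational, at most one ray for each rational.

    The margin [kap > 0] is the source of uniqueness: the field [x / t] itself has every ray through
    the origin as a solution. With [r = x / t] and a slope at most [r - kap] one gets
    [t r' <= - kap], so [r] grows at least like [kap log (1 / t)] towards [t = 0], against the
    boundedness of [a_c]. *)

Section ae_lemmas.
Context {d} {T : measurableType d} {R : realType} (m : {measure set T -> \bar R}).

Lemma ae_imp (P Q : T -> Prop) : (forall x, P x -> Q x) ->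
  {ae m, forall x, P x} -> {ae m, forall x, Q x}.
Proof.
move=> PQ [N [mN N0 sN]]; exists N; split => // x nQ.
by apply: sN => Px; apply: nQ; exact: PQ.
Qed.

Lemma ae_and (P Q : T -> Prop) : {ae m, forall x, P x} -> {ae m, forall x, Q x} ->
  {ae m, forall x, P x /\ Q x}.
Proof.
move=> [N [mN N0 sN]] [M [mM M0 sM]]; exists (N `|` M); split.
- exact: measurableU.
- by rewrite measureU0.
- move=> x nPQ; have [Px|nPx] := pselect (P x); last by left; exact: sN.
  by right; apply: sM => Qx; apply: nPQ.
Qed.

Lemma ae_forall_count (I : countType) (P : I -> T -> Prop) :
  (forall i, {ae m, forall x, P i x}) -> {ae m, forall x, forall i, P i x}.
Proof.
move=> H; pose Q n x := if unpickle n is Some i then P i x else True.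
have HQ n : {ae m, forall x, Q n x}.
  rewrite /Q; case: unpickle => [i|]; first exact: H.
  by exists set0; split => // x; apply.
apply: ae_imp (ae_foralln HQ) => x Hx i.
by have := Hx (pickle i); rewrite /Q pickleK.
Qed.
End ae_lemmas.

(** * Smooth test functions supported in cones *)

Section bump.
Context {R : realType}.
Implicit Types (P : {poly R}) (x : R).

(* The functions [P(1/x) exp(-1/x)] on [x > 0], extended by 0, are closed under
   differentiation, which gives smoothness at once. *)
Definition bump P x : R := if 0 < x then P.[x^-1] * expR (- x^-1) else 0.

(** Each monomial is absorbed by one term of the exponential series, [y ^+ i <= i! * expR y], whence
    the constant. *)
Lemma poly_expR_bounded P : exists C : R, forall y : R, 0 <= y ->
  `|P.[y] * expR (- y)| <= C.
Proof.
exists (\sum_(i < size P) `|P`_i| * (i`!)%:R) => y y0.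
rewrite horner_coef normrM (ger0_norm (expR_ge0 _)) expRN.
rewrite ler_pdivrMr ?expR_gt0// mulr_suml.
apply: (le_trans (ler_norm_sum _ _ _)); apply: ler_sum => i _.
rewrite normrM -mulrA ler_wpM2l// ger0_norm ?exprn_ge0//.
rewrite mulrC -ler_pdivrMr ?ltr0n ?fact_gt0//.
case: (i : nat) => [|n]; first by rewrite expr0 fact0 divr1 -expR0 ler_expR.
by apply: le_trans (expR_ge1Dxn n y0); rewrite lerDr.
Qed.

(** With [y = 1/x] one has [d/dx = - y^2 d/dy], which sends [P exp(-y)] to [X^2 (P - P') exp(-y)].
    At 0 the difference quotient equals [h] times the bounded quantity [(X^2 P)(1/h) exp(-1/h)]. *)
Lemma is_derive_bump P x : is_derive x 1 (bump P) (bump ('X^2 * (P - P^`())) x).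
Proof.
have [x0|x0|->] := ltgtP x 0.
- rewrite {2}/bump ltNge (ltW x0)/=.
  apply: (@near_eq_is_derive _ _ _ (cst 0)).
  near=> y; rewrite /bump ltNge.
  by have -> : y <= 0 by apply: ltW; near: y; exact: lt_nbhsl.
- rewrite {2}/bump x0.
  have xn0 : x != 0 by rewrite gt_eqF.
  have dV : is_derive x 1 (fun y : R => y^-1) (- x ^- 2).
    have := @is_deriveV R id x 1 1 xn0 (is_derive_id _ _).
    by rewrite /GRing.scale/= mulr1.
  have dP := @is_derive1_comp _ (horner P) (fun y => y^-1) x _ _ (is_derive_poly P x^-1) dV.
  have dN : is_derive x 1 (fun y : R => - y^-1) (x ^- 2).
    by have := is_deriveN dV; rewrite opprK.
  have dE := @is_derive1_comp _ expR (fun y => - y^-1) x _ _ (is_derive_expR _) dN.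
  have dF := is_deriveM dP dE.
  apply: (@is_derive_eq _ _ _ _ _ _ _ _ (@near_eq_is_derive _ _ _ _ (bump P) _ _ _ _ dF)).
    near=> y; rewrite /bump.
    by have -> : 0 < y by near: y; exact: lt_nbhsr.
  rewrite /GRing.scale/= !hornerE/= -exprVn.
  ring.
- rewrite {2}/bump ltxx.
  have [C HC] := poly_expR_bounded (P * 'X^2).
  have C0 : 0 <= C by apply: le_trans (HC 0 (lexx _)).
  have lim0 : (h^-1 *: ((bump P \o shift 0) (h *: 1) - bump P 0)) @[h --> 0^'] --> (0 : R).
    apply/cvgr0Pnorm_le => e e0; near=> h.
    have hn0 : h != 0 by near: h; exact: nbhs_dnbhs_neq.
    rewrite /bump/= ltxx subr0 addr0 /GRing.scale/= mulr1.
    case: ifPn => [h0|_]; last by rewrite mulr0 normr0 ltW.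
    have := HC h^-1; rewrite invr_ge0 (ltW h0) => /(_ isT).
    rewrite !hornerE /= => H.
    have -> : h^-1 * P.[h^-1] * expR (- h^-1) =
        h * (P.[h^-1] / h / h * expR (- h^-1)) by field.
    rewrite normrM (gtr0_norm h0).
    apply: (le_trans (ler_wpM2l (ltW h0) H)).
    apply: (@le_trans _ _ (h * (C + 1))); first by rewrite ler_wpM2l ?ltW// ltrDl.
    rewrite -ler_pdivlMr ?ltr_wpDl//.
    apply: (le_trans (ler_norm h)).
    near: h; apply: (@dnbhs0_le _ R).
    by rewrite divr_gt0// ltr_wpDl.
  split; first by apply/cvg_ex; exists 0; exact: lim0.
  exact/(cvg_lim _ lim0).
Unshelve. all: by end_near. Qed.

Lemma continuous_bump P : continuous (bump P).
Proof.
move=> x; apply: differentiable_continuous; apply/derivable1_diffP.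
by have [] := is_derive_bump P x.
Qed.

Lemma bump1_gt0 x : 0 < x -> 0 < bump 1 x.
Proof. by move=> x0; rewrite /bump x0 hornerE mul1r expR_gt0. Qed.

Lemma bump1_ge0 x : 0 <= bump 1 x.
Proof. by have [/bump1_gt0/ltW//|x0] := ltP 0 x; rewrite /bump ltNge x0. Qed.

Lemma bump1_eq0 x : x <= 0 -> bump 1 x = 0.
Proof. by move=> x0; rewrite /bump ltNge x0. Qed.

Lemma dbump1E x : bump ('X^2 * (1 - 1^`())) x = x^-1 ^+ 2 * bump 1 x.
Proof.
rewrite /bump; case: ifP => [_|]; last by rewrite mulr0.
by rewrite -polyC1 derivC subr0 mulr1 hornerXn hornerC mul1r.
Qed.

Lemma is_derive_bump_affine P (a b d : R) (p v : R * R) :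
  is_derive p v (fun q => bump P (a * q.1 + b * q.2 + d))
    ((a * v.1 + b * v.2) * bump ('X^2 * (P - P^`())) (a * p.1 + b * p.2 + d)).
Proof.
set l := a * p.1 + b * p.2 + d; set k := a * v.1 + b * v.2.
have dl : is_derive (0 : R) 1 (fun h : R => l + h * k) k.
  have dk := is_derive_cst k (0 : R) (1 : R).
  have := is_deriveD (is_derive_cst l (0 : R) (1 : R))
    (is_deriveM (is_derive_id (0 : R) 1) dk).
  by rewrite /GRing.scale/= mul0r !add0r mulr1.
have db : is_derive (l + 0 * k) 1 (bump P) (bump ('X^2 * (P - P^`())) l).
  rewrite mul0r addr0; exact: is_derive_bump.
have := @is_derive1_comp _ (bump P) (fun h => l + h * k) 0 _ _ db dl.
rewrite mulrC => -[dc vc].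
have E : (fun h : R => h^-1 *: (((bump P \o (fun h => l + h * k)) \o shift 0) (h *: 1)
     - (bump P \o (fun h => l + h * k)) 0)) =
   (fun h : R => h^-1 *: (((fun q => bump P (a * q.1 + b * q.2 + d)) \o shift p) (h *: v)
     - (bump P (a * p.1 + b * p.2 + d)))).
  apply/funext => h /=; congr (h^-1 *: (bump P _ - bump P _)).
    by rewrite /l /k /GRing.scale/=; ring.
  by rewrite mul0r addr0.
split; first by move: dc; rewrite /derivable E.
by move: vc; rewrite /derive E.
Qed.

Lemma continuous_bump_affine P (a b d : R) :
  continuous (fun q : R * R => bump P (a * q.1 + b * q.2 + d)).
Proof.
move=> q; apply: (@continuous_comp _ _ _ (fun q : R * R => a * q.1 + b * q.2 + d)).
  apply: cvgD; last exact: cvg_cst.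
  apply: cvgD; apply: cvgM; [exact: cvg_cst|exact: cvg_fst|exact: cvg_cst|exact: cvg_snd].
exact: continuous_bump.
Qed.

Lemma CnW n (phi : R * R -> R) : Cn n.+1 phi -> Cn n phi.
Proof.
elim: n phi => [|n IH] phi; first by case.
by case=> c d x t; split; [exact: c|exact: d|exact: IH x|exact: IH t].
Qed.

Lemma CnD n (phi psi : R * R -> R) :
  Cn n phi -> Cn n psi -> Cn n (fun p => phi p + psi p).
Proof.
elim: n phi psi => [|n IH] phi psi /=.
  by move=> c1 c2 p; apply: cvgD; [exact: c1|exact: c2].
move=> [c1 d1 x1 t1] [c2 d2 x2 t2]; split.
- by move=> p; apply: cvgD; [exact: c1|exact: c2].
- move=> p; have [a1 b1] := d1 p; have [a2 b2] := d2 p.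
  by split; [exact: (derivableD a1 a2)|exact: (derivableD b1 b2)].
- have -> : dx (fun p => phi p + psi p) = (fun p => dx phi p + dx psi p).
    by apply/funext => p; exact: (deriveD (d1 p).1 (d2 p).1).
  exact: IH.
- have -> : dt (fun p => phi p + psi p) = (fun p => dt phi p + dt psi p).
    by apply/funext => p; exact: (deriveD (d1 p).2 (d2 p).2).
  exact: IH.
Qed.

Lemma dxM (phi psi : R * R -> R) p :
  derivable phi p (1, 0) -> derivable psi p (1, 0) ->
  dx (fun p => phi p * psi p) p = phi p * dx psi p + psi p * dx phi p.
Proof. by move=> d1 d2; exact: (deriveM d1 d2). Qed.

Lemma dtM (phi psi : R * R -> R) p :
  derivable phi p (0, 1) -> derivable psi p (0, 1) ->
  dt (fun p => phi p * psi p) p = phi p * dt psi p + psi p * dt phi p.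
Proof. by move=> d1 d2; exact: (deriveM d1 d2). Qed.

Lemma CnM n (phi psi : R * R -> R) :
  Cn n phi -> Cn n psi -> Cn n (fun p => phi p * psi p).
Proof.
elim: n phi psi => [|n IH] phi psi.
  by move=> c1 c2 p; apply: cvgM; [exact: c1|exact: c2].
move=> C1 C2; have C1' := CnW C1; have C2' := CnW C2.
case: C1 C2 => [c1 d1 x1 t1] [c2 d2 x2 t2]; split.
- by move=> p; apply: cvgM; [exact: c1|exact: c2].
- move=> p; have [a1 b1] := d1 p; have [a2 b2] := d2 p.
  by split; [exact: (derivableM a1 a2)|exact: (derivableM b1 b2)].
- have -> : dx (fun p => phi p * psi p) =
      (fun p => phi p * dx psi p + psi p * dx phi p).
    by apply/funext => p; apply: dxM; [case: (d1 p)|case: (d2 p)].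
  by apply: CnD; exact: IH.
- have -> : dt (fun p => phi p * psi p) =
      (fun p => phi p * dt psi p + psi p * dt phi p).
    by apply/funext => p; apply: dtM; [case: (d1 p)|case: (d2 p)].
  by apply: CnD; exact: IH.
Qed.

Lemma Cn_cst n (k : R) : Cn n (fun=> k).
Proof.
elim: n k => [|n IH] k /=; first by move=> p; exact: cvg_cst.
split; first by move=> p; exact: cvg_cst.
- by move=> p; split; exact: derivable_cst.
- have -> : dx (fun=> k) = (fun=> 0); last exact: IH.
  by apply/funext => p; rewrite /dx derive_cst.
- have -> : dt (fun=> k) = (fun=> 0); last exact: IH.
  by apply/funext => p; rewrite /dt derive_cst.
Qed.

Lemma dx_bump_affine P (a b d : R) :
  dx (fun q => bump P (a * q.1 + b * q.2 + d)) =
  (fun q => a * bump ('X^2 * (P - P^`())) (a * q.1 + b * q.2 + d)).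
Proof.
apply/funext => q; have [_] := is_derive_bump_affine P a b d q (1, 0).
by rewrite /dx/= => ->; rewrite mulr1 mulr0 addr0.
Qed.

Lemma dt_bump_affine P (a b d : R) :
  dt (fun q => bump P (a * q.1 + b * q.2 + d)) =
  (fun q => b * bump ('X^2 * (P - P^`())) (a * q.1 + b * q.2 + d)).
Proof.
apply/funext => q; have [_] := is_derive_bump_affine P a b d q (0, 1).
by rewrite /dt/= => ->; rewrite mulr0 mulr1 add0r.
Qed.

Lemma Cn_bump_affine n P (a b d : R) :
  Cn n (fun q => bump P (a * q.1 + b * q.2 + d)).
Proof.
elim: n P => [|n IH] P; first exact: continuous_bump_affine.
split; first exact: continuous_bump_affine.
- by move=> p; split; apply: ex_derive; exact: is_derive_bump_affine.
- by rewrite dx_bump_affine; apply: CnM; [exact: Cn_cst|exact: IH].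
- by rewrite dt_bump_affine; apply: CnM; [exact: Cn_cst|exact: IH].
Qed.

End bump.

Section cone_test.
Context {R : realType}.
Implicit Types (p : R * R).

Lemma bump_bounded (P : {poly R}) : exists2 C : R, 0 <= C & forall x, `|bump P x| <= C.
Proof.
have [C HC] := poly_expR_bounded P.
have C0 : 0 <= C by apply: le_trans (HC 0 (lexx _)).
exists C => // x; rewrite /bump; case: ifPn => [x0|_]; last by rewrite normr0.
by apply: HC; rewrite invr_ge0 ltW.
Qed.

Definition dbump : R -> R := bump ('X^2 * (1 - 1^`())).

Lemma dbump_ge0 x : 0 <= dbump x.
Proof. by rewrite /dbump dbump1E mulr_ge0 ?bump1_ge0// sqr_ge0. Qed.

Lemma dbump_eq0 x : x <= 0 -> dbump x = 0.
Proof. by move=> x0; rewrite /dbump dbump1E bump1_eq0// mulr0. Qed.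

Variables (e x0 s X L T : R).

(** All four forms keep the shape [a * p.1 + b * p.2 + d], zero coefficients included, so that the
    formulas for the derivatives of [bump] along an affine form rewrite directly. The constant
    [T + 1] in [cone4] makes it exceed [cone3] for [t >= 0]. *)
Definition cone1 p : R := e * p.1 + (- (e * s)) * p.2 + (- (e * x0)).
Definition cone2 p : R := (- e) * p.1 + (- L) * p.2 + X.
Definition cone3 p : R := 0 * p.1 + (- 1) * p.2 + T.
Definition cone4 p : R := 0 * p.1 + 1 * p.2 + (T + 1).

(* [cone1] is positive on the cone [e (x - x0 - s t) > 0]; [cone2] cuts it at a
   line moving inward faster than any signal; the product of the last two
   factors depends on [t] only, is compactly supported, and decreases on [0, T]. *)
Definition cone_test p : R :=
  bump 1 (cone1 p) * bump 1 (cone2 p) * (bump 1 (cone3 p) * bump 1 (cone4 p)).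

Lemma dx_cone_test p : dx cone_test p =
  e * (dbump (cone1 p) * bump 1 (cone2 p) * (bump 1 (cone3 p) * bump 1 (cone4 p)))
  - e * (bump 1 (cone1 p) * dbump (cone2 p) * (bump 1 (cone3 p) * bump 1 (cone4 p))).
Proof.
have D (a b d : R) : derivable (fun q : R * R => bump 1 (a * q.1 + b * q.2 + d)) p
    ((1, 0) : R * R).
  by apply: ex_derive; exact: is_derive_bump_affine.
have E (a b d : R) := congr1 (fun g => g p) (dx_bump_affine (1 : {poly R}) a b d).
rewrite /cone_test dxM; last 2 first.
- by apply: derivableM; exact: D.
- by apply: derivableM; exact: D.
rewrite dxM; try exact: D.
rewrite dxM; try exact: D.
by rewrite !E -/dbump -/(cone1 p) -/(cone2 p) -/(cone3 p) -/(cone4 p); ring.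
Qed.

Lemma dt_cone_test p : dt cone_test p =
  - (e * s) * (dbump (cone1 p) * bump 1 (cone2 p) * (bump 1 (cone3 p) * bump 1 (cone4 p)))
  - L * (bump 1 (cone1 p) * dbump (cone2 p) * (bump 1 (cone3 p) * bump 1 (cone4 p)))
  + bump 1 (cone1 p) * bump 1 (cone2 p) *
    (bump 1 (cone3 p) * dbump (cone4 p) - dbump (cone3 p) * bump 1 (cone4 p)).
Proof.
have D (a b d : R) : derivable (fun q : R * R => bump 1 (a * q.1 + b * q.2 + d)) p
    ((0, 1) : R * R).
  by apply: ex_derive; exact: is_derive_bump_affine.
have E (a b d : R) := congr1 (fun g => g p) (dt_bump_affine (1 : {poly R}) a b d).
rewrite /cone_test dtM; last 2 first.
- by apply: derivableM; exact: D.
- by apply: derivableM; exact: D.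
rewrite dtM; try exact: D.
rewrite dtM; try exact: D.
by rewrite !E -/dbump -/(cone1 p) -/(cone2 p) -/(cone3 p) -/(cone4 p); ring.
Qed.

Lemma cone_test_ge0 p : 0 <= cone_test p.
Proof. by rewrite !mulr_ge0 ?bump1_ge0. Qed.

(** A bound for both edges, of slopes [s] and, up to sign, [L], over the times [|t| <= |T| + 1]. *)
Definition cone_radius : R :=
  `|x0| + `|X| + (`|s| + `|L|) * (`|T| + 1).

Lemma cone_supportP p : e = 1 \/ e = -1 ->
  0 < cone1 p -> 0 < cone2 p -> 0 < cone3 p -> 0 < cone4 p ->
  - cone_radius <= p.1 <= cone_radius /\ - (`|T| + 1) <= p.2 <= `|T| + 1.
Proof.
move=> e1; rewrite /cone1 /cone2 /cone3 /cone4 => h1 h2 h3 h4.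
have hT := ler_norm T; have hT0 := normr_ge0 T.
have t1 : p.2 <= `|T| + 1 by lra.
have t2 : - (`|T| + 1) <= p.2 by lra.
have tb : `|p.2| <= `|T| + 1 by rewrite ler_norml t2 t1.
have hs : `|s * p.2| <= `|s| * (`|T| + 1) by rewrite normrM ler_wpM2l.
have hL : `|L * p.2| <= `|L| * (`|T| + 1) by rewrite normrM ler_wpM2l.
have [] := (ler_norm x0, ler_norm X); have := ler_norm (- x0).
have := ler_norm (- X); rewrite !normrN => a1 a2 a3 a4.
have s1 := ler_norm (s * p.2); have s2 := ler_norm (- (s * p.2)).
have l1 := ler_norm (L * p.2); have l2 := ler_norm (- (L * p.2)).
rewrite !normrN in s2 l2.
have b1 := normr_ge0 x0; have b2 := normr_ge0 X.
split; last lra.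
rewrite /cone_radius mulrDl.
by case: e1 h1 h2 => ->; rewrite ?mulN1r ?mul1r ?opprK => h1 h2; apply/andP; split; lra.
Qed.

Lemma cone_test_test : e = 1 \/ e = -1 -> test_function cone_test.
Proof.
move=> e1; split.
  by move=> n; rewrite /cone_test; apply: CnM; apply: CnM; exact: Cn_bump_affine.
set K := `[- cone_radius, cone_radius]%classic `*` `[- (`|T| + 1), `|T| + 1]%classic.
have cK : compact K by apply: compact_setX; exact: segment_compact.
apply: (subclosed_compact _ cK); first exact: closed_closure.
have clK : closed K by apply: compact_closed.
have -> : K = closure K by apply/closure_id.
apply: closure_subset => p /= phi0.
have pos x : bump 1 x != 0 -> 0 < x.
  by have [/bump1_eq0 ->|] := leP x 0; rewrite ?eqxx.
move: phi0; rewrite /cone_test !mulf_eq0 !negb_or.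
move=> /andP[/andP[/pos h1 /pos h2] /andP[/pos h3 /pos h4]].
have [k1 k2] := cone_supportP e1 h1 h2 h3 h4.
by split; rewrite /= in_itv.
Qed.

(** The space-time integrand of [weak_form] for this test function, with [h] and [q] standing for
    the values of the entropy and of its flux at [u p]. *)
Definition cone_flux (h q : R) p : R := h * dt cone_test p + q * dx cone_test p.

Lemma cone_flux_eq0 h q p :
  e = 1 \/ e = -1 ->
  ~~ (`|p.1| <= cone_radius) || ~~ (`|p.2| <= `|T| + 1) -> cone_flux h q p = 0.
Proof.
move=> e1 pK.
have : cone1 p <= 0 \/ cone2 p <= 0 \/ cone3 p <= 0 \/ cone4 p <= 0.
  have [|h1] := leP (cone1 p) 0; first by left.
  have [|h2] := leP (cone2 p) 0; first by right; left.
  have [|h3] := leP (cone3 p) 0; first by right; right; left.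
  have [|h4] := leP (cone4 p) 0; first by right; right; right.
  have [k1 k2] := cone_supportP e1 h1 h2 h3 h4.
  by move: pK; rewrite !ler_norml k1 k2.
rewrite /cone_flux dt_cone_test dx_cone_test.
by case => [c|[c|[c|c]]]; rewrite (bump1_eq0 c) (dbump_eq0 c); ring.
Qed.

Lemma cone_flux_bound (M : R) : exists2 C : R, 0 <= C & forall h q p,
  `|h| <= M -> `|q| <= M -> `|cone_flux h q p| <= C.
Proof.
have [C1 C10 HC1] := bump_bounded 1.
have [C2 C20 HC2] := bump_bounded ('X^2 * (1 - 1^`())).
pose C := C1 + C2.
have C0 : 0 <= C by rewrite addr_ge0.
have b1 x : `|bump 1 x| <= C by apply: le_trans (HC1 x) _; rewrite lerDl.
have b2 x : `|dbump x| <= C by apply: le_trans (HC2 x) _; rewrite lerDr.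
have prod4 a b c d : `|a| <= C -> `|b| <= C -> `|c| <= C -> `|d| <= C ->
    `|a * b * (c * d)| <= C * C * (C * C).
  move=> *; rewrite !normrM; do 3 (apply: ler_pM; rewrite ?mulr_ge0//).
set K := C * C * (C * C) in prod4.
have K0 : 0 <= K by rewrite !mulr_ge0.
have dxb p : `|dx cone_test p| <= `|e| * K + `|e| * K.
  rewrite dx_cone_test; apply: le_trans (ler_normB _ _) _.
  by rewrite lerD// normrM ler_wpM2l// prod4.
have dtb p : `|dt cone_test p| <= `|e * s| * K + `|L| * K + (K + K).
  rewrite dt_cone_test; apply: le_trans (ler_normD _ _) _; apply: lerD.
    apply: le_trans (ler_normB _ _) _.
    by rewrite lerD// normrM ?normrN ler_wpM2l// prod4.
  rewrite mulrBr; apply: le_trans (ler_normB _ _) _.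
  by rewrite lerD// prod4.
exists (`|M| * (`|e * s| * K + `|L| * K + (K + K)) + `|M| * (`|e| * K + `|e| * K)).
  by rewrite !(addr_ge0, mulr_ge0).
move=> h q p hM qM; apply: le_trans (ler_normD _ _) _.
have MM := ler_norm M.
by rewrite lerD// normrM ler_pM// (le_trans _ MM).
Qed.

(** The integrand splits into three nonpositive terms: the flux through the edge of slope [s], the
    flux through the outer edge, which moves at least as fast as any signal since [|q| <= L * h],
    and the decay of the time factor. In the open truncated cone the last one is a strictly negative
    multiple of [h], so equality forces [h = 0]. *)
Lemma cone_flux_le0 h q p : e = 1 \/ e = -1 -> 0 <= h ->
  e * q <= e * s * h -> `|q| <= L * h -> 0 <= p.2 ->
  cone_flux h q p <= 0 /\
  (cone_flux h q p = 0 -> 0 < cone1 p -> 0 < cone2 p -> 0 < cone3 p -> h = 0).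
Proof.
move=> e1 h0 qs qL t0.
set B1 := bump 1 (cone1 p); set B2 := bump 1 (cone2 p).
set B3 := bump 1 (cone3 p); set B4 := bump 1 (cone4 p).
have B10 : 0 <= B1 := bump1_ge0 _. have B20 : 0 <= B2 := bump1_ge0 _.
have B30 : 0 <= B3 := bump1_ge0 _. have B40 : 0 <= B4 := bump1_ge0 _.
have D10 := dbump_ge0 (cone1 p); have D20 := dbump_ge0 (cone2 p).
have theta0 : B3 * dbump (cone4 p) - dbump (cone3 p) * B4 <= 0 /\
   (0 < cone3 p -> B3 * dbump (cone4 p) - dbump (cone3 p) * B4 < 0).
  have [h3|h3] := leP (cone3 p) 0.
    by rewrite /B3 (bump1_eq0 h3) (dbump_eq0 h3) !mul0r subrr; split => //; rewrite ltNge h3.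
  (* Since [dbump x] is [bump 1 x] divided by [x ^+ 2], the sign is decided by
     [cone3 p < cone4 p]. *)
  have -> : B3 * dbump (cone4 p) - dbump (cone3 p) * B4 =
      B3 * B4 * ((cone4 p)^-1 ^+ 2 - (cone3 p)^-1 ^+ 2).
    by rewrite /dbump !dbump1E -/B3 -/B4; ring.
  have h34 : cone3 p < cone4 p by move: h3; rewrite /cone3 /cone4; lra.
  have h4 : 0 < cone4 p by lra.
  suff H : B3 * B4 * ((cone4 p)^-1 ^+ 2 - (cone3 p)^-1 ^+ 2) < 0 by rewrite ltW.
  rewrite pmulr_rlt0 ?mulr_gt0 ?bump1_gt0//.
  by rewrite subr_lt0 ltrXn2r// ?invr_ge0 ?ltW// ltf_pV2.
have [th1 th2] := theta0.
have -> : cone_flux h q p =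
    dbump (cone1 p) * B2 * (B3 * B4) * (e * q - e * s * h) +
    B1 * dbump (cone2 p) * (B3 * B4) * (- (L * h) - e * q) +
    B1 * B2 * h * (B3 * dbump (cone4 p) - dbump (cone3 p) * B4).
  by rewrite /cone_flux dt_cone_test dx_cone_test -/B1 -/B2 -/B3 -/B4; ring.
have eq : - (e * q) <= L * h.
  apply: le_trans qL; case: e1 => ->; rewrite ?mul1r ?mulN1r ?opprK.
    by rewrite -normrN ler_norm.
  exact: ler_norm.
have n1 : dbump (cone1 p) * B2 * (B3 * B4) * (e * q - e * s * h) <= 0.
  by apply: mulr_ge0_le0; rewrite ?subr_le0// !mulr_ge0.
have n2 : B1 * dbump (cone2 p) * (B3 * B4) * (- (L * h) - e * q) <= 0.
  apply: mulr_ge0_le0; first by rewrite !mulr_ge0.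
  by rewrite addrC subr_le0.
have n3 : B1 * B2 * h * (B3 * dbump (cone4 p) - dbump (cone3 p) * B4) <= 0.
  by apply: mulr_ge0_le0; rewrite // !mulr_ge0.
split; first by lra.
move=> E c1 c2 c3.
have /eqP : B1 * B2 * h * (B3 * dbump (cone4 p) - dbump (cone3 p) * B4) = 0 by lra.
rewrite !mulf_eq0 (gt_eqF (bump1_gt0 c1)) (gt_eqF (bump1_gt0 c2)).
by rewrite (lt_eqF (th2 c3)) orbF => /eqP.
Qed.

End cone_test.

(** * Differential inequalities for absolutely continuous functions *)

Section abs_continuous.
Context {R : realType}.
Local Notation mu := (@lebesgue_measure R).

(** Let [z] be the supremum of the points where [P] holds. The step at [z] starts from such a point
    close to [z] and reaches beyond [z], unless [z = b]. *)
Lemma interval_induction (a b : R) (P : R -> Prop) : a <= b -> P a ->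
  (forall z, a <= z <= b -> exists2 d : R, 0 < d & forall s t,
     a <= s -> z - d < s -> s <= z -> z <= t -> t < z + d -> t <= b ->
     P s -> P t) -> P b.
Proof.
move=> ab Pa step.
pose S := [set t | a <= t <= b /\ P t].
have Sa : S a by split; rewrite // lexx ab.
have hS : has_sup S by split; [exists a; exact: Sa|exists b => t [/andP[]]].
pose z := sup S.
have az : a <= z by exact: (ub_le_sup hS.2 Sa).
have zb : z <= b by apply: ge_sup; [exists a; exact: Sa|move=> t [/andP[]]].
have [|d d0 H] := step z; first by rewrite az zb.
have [s [/andP[a_s sb] Ps] zs] := sup_adherent d0 hS.
have sz : s <= z by apply: (ub_le_sup hS.2); split; rewrite ?a_s.
have [->|nb] := eqVneq b z.
  by apply: (H s z) => //; rewrite ltrDl.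
have zltb : z < b by rewrite lt_neqAle eq_sym nb.
pose t := Num.min (z + d / 2) b.
have zt : z < t by rewrite lt_min zltb andbT ltrDl divr_gt0.
have tb : t <= b by rewrite ge_min lexx orbT.
have Pt : P t.
  apply: (H s t) => //; first exact: ltW.
  by rewrite gt_min ltrD2l ltr_pdivrMr// ltr_pMr// ltr1n.
have : t <= z.
  by apply: (ub_le_sup hS.2); split; rewrite // tb andbT (le_trans az (ltW zt)).
by rewrite leNgt zt.
Qed.

(** A finite family of non-overlapping intervals whose interiors lie in [U], listed from right to
    left, so that advancing to the right is a [cons]. *)
Fixpoint chain (U : set R) (t : R) (l : seq (R * R)) : Prop :=
  if l is p :: l' then
    [/\ p.1 <= p.2, p.2 <= t, `]p.1, p.2[%classic `<=` U & chain U p.1 l']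
  else True.

Lemma chain_le U t t' l : t <= t' -> chain U t l -> chain U t' l.
Proof. by case: l => //= p l tt' [? h ? ?]; split => //; exact: le_trans h tt'. Qed.

Lemma chain_nth U t l i : chain U t l -> (i < size l)%N ->
  (nth (0, 0) l i).1 <= (nth (0, 0) l i).2 <= t.
Proof.
elim: l t i => [//|p l IH] t [|i]/=; first by move=> [-> ->].
by move=> [h1 h2 _ c] /(IH _ _ c)/andP[-> /le_trans ->]//; exact: le_trans h1 h2.
Qed.

Lemma chain_nth_lt U t l i j : chain U t l -> (i < j)%N -> (j < size l)%N ->
  (nth (0, 0) l j).2 <= (nth (0, 0) l i).1.
Proof.
elim: l t i j => [//|p l IH] t [|i] [|j]//=.
  by move=> [_ _ _ c] _ jl; have /andP[] := chain_nth c jl.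
by move=> [_ _ _ c]; rewrite !ltnS; exact: (IH _ _ _ c).
Qed.

Lemma chain_measure U t l : open U -> chain U t l ->
  ((\sum_(p <- l) (p.2 - p.1))%:E <= mu (U `&` `]-oo, t[%classic))%E.
Proof.
move=> oU; have mU : measurable U by exact: open_measurable.
have mI (s : R) : measurable (U `&` `]-oo, s[%classic) by exact: measurableI.
elim: l t => [t _|p l IH t [p12 p2t pU /IH H]]; first by rewrite big_nil measure_ge0.
rewrite big_cons EFinD.
have -> : ((p.2 - p.1)%:E = mu `]p.1, p.2[%classic)%E.
  rewrite lebesgue_measure_itv/= lte_fin; case: ltP => // p21.
  by rewrite (@le_anti _ _ p.1 p.2) ?subrr// p12 p21.
apply: (le_trans (leeD2l _ H)).
rewrite -measureU//.
  apply: le_measure; rewrite ?inE//.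
    by apply: measurableU; [exact: measurable_itv|exact: mI].
    exact: mI.
   move=> y [/= /[dup] yp /pU Uy|[Uy /= yp]]; split => //=; move: yp => /=;
    rewrite !in_itv/=.
    by move=> /andP[_ yp2]; exact: lt_le_trans yp2 p2t.
  by move=> yp; apply: (lt_le_trans yp); exact: le_trans p12 p2t.
  exact: mI.
rewrite -subset0 => y [/=]; rewrite !in_itv/= => /andP[py _] [_ yp].
by have := lt_trans py yp; rewrite ltxx.
Qed.

Lemma abs_continuous_chain a b (x : R -> R) e (d : R) U l :
  (forall (n : nat) (s r : 'I_n -> R),
      (forall i, a <= s i /\ s i <= r i /\ r i <= b) ->
      trivIset setT (fun i => `]s i, r i[%classic) ->
      \sum_(i < n) (r i - s i) < d ->
      \sum_(i < n) `|x (r i) - x (s i)| < e) ->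
  open U -> (mu U < d%:E)%E -> chain U b l -> (forall p, p \in l -> a <= p.1) ->
  \sum_(p <- l) `|x p.2 - x p.1| < e.
Proof.
move=> H oU Ud cl al.
rewrite (big_nth (0, 0)) big_mkord.
apply: (H _ (fun i => (nth (0, 0) l i).1) (fun i => (nth (0, 0) l i).2)).
- move=> i; have /andP[-> ->] := chain_nth cl (ltn_ord i).
  by split => //; exact/al/mem_nth.
- move=> i j _ _ [y [/=]]; rewrite !in_itv/= => /andP[i1 i2] /andP[j1 j2].
  apply/val_inj/eqP; case: ltngtP => //= ij.
    have := chain_nth_lt cl ij (ltn_ord j).
    by rewrite leNgt (lt_trans i1 j2).
  have := chain_nth_lt cl ij (ltn_ord i).
  by rewrite leNgt (lt_trans j1 i2).
- have -> : \sum_(i < size l) ((nth (0, 0) l i).2 - (nth (0, 0) l i).1) =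
    \sum_(p <- l) (p.2 - p.1) by rewrite (big_nth (0, 0)) big_mkord.
  rewrite -lte_fin; apply: le_lt_trans (chain_measure oU cl) _.
  apply: le_lt_trans Ud; apply: le_measure; rewrite ?inE.
  + by apply: measurableI => //; exact: open_measurable.
  + exact: open_measurable.
  + exact: subIsetl.
Qed.

Lemma derive1_le_near (x : R -> R) (t C e : R) : derivable x t 1 ->
  derive1 x t <= C -> 0 < e ->
  exists2 d : R, 0 < d & forall s, `|s - t| < d ->
    (t <= s -> x s - x t <= (C + e) * (s - t)) /\
    (s <= t -> x t - x s <= (C + e) * (t - s)).
Proof.
move=> dx xC e0; move: xC; rewrite derive1E => xC.
have /cvgrPdist_lt/(_ e e0) : (h^-1 *: ((x \o shift t) (h *: 1) - x t)) @[h --> 0^']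
  --> 'D_1 x t by exact: dx.
move=> /nbhs_ballP[d /= d0 H]; exists d => // s sd.
have [->|st] := eqVneq s t; first by rewrite !subrr !mulr0.
have := H (s - t); rewrite /= /ball/= sub0r normrN => /(_ sd).
rewrite subr_eq0 => /(_ st); rewrite /GRing.scale/= mulr1 subrK => {}H.
have {}H : (s - t)^-1 * (x s - x t) < C + e.
  rewrite distrC in H.
  by have := ler_norm ((s - t)^-1 * (x s - x t) - 'D_1 x t); lra.
split=> ts.
  have st0 : 0 < s - t by rewrite subr_gt0 lt_neqAle eq_sym st.
  by rewrite ltW// -ltr_pdivrMr// mulrC.
have st0 : 0 < t - s by rewrite subr_gt0 lt_neqAle st.
rewrite ltW// -ltr_pdivrMr//; apply: le_lt_trans H.
rewrite le_eqVlt; apply/orP; left; apply/eqP; field.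
by rewrite !subr_eq0 st eq_sym st.
Qed.

(* Interval induction: a point where the derivative is at most [C] advances by
   itself; the remaining points lie in an open set of small measure, where the
   increments of [x] are recorded in a chain and absorbed by absolute continuity. *)
Lemma abs_continuous_le (a b C : R) (x : R -> R) : a <= b ->
  abs_continuous a b x ->
  {ae mu, forall t, a < t < b -> derivable x t 1 /\ derive1 x t <= C} ->
  x b - x a <= C * (b - a).
Proof.
move=> ab acx [N [mN N0 badN]].
suff H e : 0 < e -> x b - x a <= (C + e) * (b - a) + (e + e).
  apply/ler_addgt0Pr => e e0.
  pose e' := e / (b - a + 2).
  have ba0 : 0 < b - a + 2 by rewrite ltr_wpDl// subr_ge0.
  apply: (le_trans (H e' _)); first by rewrite divr_gt0.
  rewrite le_eqVlt; apply/orP; left; apply/eqP; rewrite /e'; field.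
  by rewrite gt_eqF.
move=> e0; have [d' d'0 Hd'] := acx e e0.
pose K := `|C + e|; have K0 : 0 <= K := normr_ge0 _.
pose d := Num.min d' (e / (K + 1)).
have d0 : 0 < d by rewrite lt_min d'0 divr_gt0// ltr_wpDl.
have Kd : K * d <= e.
  apply: (@le_trans _ _ ((K + 1) * d)); first by rewrite ler_wpM2r ?ltW// ltrDl.
  by rewrite mulrC -ler_pdivlMr ?ltr_wpDl// ge_min lexx orbT.
(* The endpoints are added because the derivative is controlled only strictly between them. *)
pose N' := N `|` ([set a] `|` [set b]).
have mN' : measurable N' by apply: measurableU => //; apply: measurableU.
have N'0 : mu N' = 0%E.
  have ab0 : mu ([set a] `|` [set b]) = 0%E.
    rewrite measureU0; [exact: lebesgue_measure_set1|by []|by []|exact: lebesgue_measure_set1].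
  by rewrite measureU0//; exact: measurableU.
have [|U [oU NU mUN]] := @lebesgue_regularity_outer R N' d mN' _ d0.
  by rewrite [X in (X < _)%E]N'0 ltry.
have Ud : (mu U < d%:E)%E.
  have -> : U = N' `|` (U `\` N') by rewrite setDUK.
  apply: le_lt_trans (measureU2 _ _ _) _ => //.
    by apply: measurableD => //; exact: open_measurable.
  by rewrite [X in (X + _)%E]N'0 add0e.
(* Inside [U] the increment of [x] is charged to the chain. The term [K * (p.2 - p.1)] pays for
   [(C + e) * (p.2 - p.1)] on the right-hand side, which may be negative. *)
pose P t := exists l : seq (R * R), [/\ chain U t l, (forall p, p \in l -> a <= p.1) &
  x t - x a <= (C + e) * (t - a) + \sum_(p <- l) (`|x p.2 - x p.1| + K * (p.2 - p.1))].
have [l [cl al xl]] : P b.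
  apply: (interval_induction ab).
    by exists [::]; split => //; rewrite !subrr mulr0 big_nil addr0.
  move=> z /andP[az zb].
  have [zU|zU] := pselect (U z).
    have /nbhs_ballP[r /= r0 rU] := open_nbhs_nbhs (conj oU zU).
    exists r => // s t a_s zs sz zt tr tb [l [cl al xl]].
    exists ((s, t) :: l); split => /=.
    - split => //; first exact: le_trans sz zt.
      move=> y /=; rewrite in_itv/= => /andP[sy yt]; apply: rU.
      by rewrite /ball/= ltr_distlC; apply/andP; split; lra.
    - by move=> p; rewrite inE => /predU1P[->//|/al].
    - rewrite big_cons/=; apply: (@le_trans _ _ (`|x t - x s| + (x s - x a))).
        by have := ler_norm (x t - x s); lra.
      have : - (C + e) * (t - s) <= K * (t - s).
        apply: ler_wpM2r; first by rewrite subr_ge0 (le_trans sz zt).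
        by rewrite /K -(normrN (C + e)) ler_norm.
      by lra.
  have zab : a < z < b.
    rewrite !lt_neqAle az zb !andbT; apply/andP; split; apply/eqP => E.
      by apply: zU; apply: NU; right; left; rewrite /= E.
    by apply: zU; apply: NU; right; right; rewrite /= E.
  have [dz xz] : derivable x z 1 /\ derive1 x z <= C.
    apply: contrapT => nz; apply: zU; apply: NU; left; apply: badN => /= /(_ zab).
    exact: nz.
  have [r r0 H] := derive1_le_near dz xz e0.
  exists r => // s t a_s zs sz zt tr tb [l [cl al xl]].
  exists l; split => //; first by apply: chain_le cl; exact: le_trans sz zt.
  have [|_ /(_ sz) h1] := H s; first by rewrite distrC ger0_norm ?subr_ge0//; lra.
  have [|/(_ zt) h2 _] := H t; first by rewrite ger0_norm ?subr_ge0//; lra.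
  by lra.
have d'U : (mu U < d'%:E)%E.
  by apply: lt_le_trans Ud _; rewrite lee_fin ge_min lexx.
have := abs_continuous_chain Hd' oU d'U cl al.
have : K * (\sum_(p <- l) (p.2 - p.1)) <= e.
  apply: le_trans Kd; apply: ler_wpM2l => //; rewrite -lee_fin.
  apply: le_trans (chain_measure oU cl) _; apply: le_trans (ltW Ud).
  apply: le_measure; rewrite ?inE; last exact: subIsetl.
    by apply: measurableI => //; exact: open_measurable.
  exact: open_measurable.
move: xl; rewrite big_split/= -mulr_sumr; lra.
Qed.
End abs_continuous.

(** * A barrier for the ratio of position to time *)

Section barrier.
Context {R : realType}.
Local Notation mu := (@lebesgue_measure R).

Lemma abs_continuousS (a b a' b' : R) x : a <= a' -> b' <= b ->
  abs_continuous a b x -> abs_continuous a' b' x.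
Proof.
move=> aa bb H e /H[d d0 {}H]; exists d => // n s r sr; apply: H => i.
have [h1 [h2 h3]] := sr i.
by rewrite (le_trans aa h1) h2 (le_trans h3 bb).
Qed.

Lemma abs_continuous_dist (a b : R) x e : abs_continuous a b x -> 0 < e ->
  exists2 d : R, 0 < d & forall s t, a <= s -> s <= t -> t <= b -> t - s < d ->
    `|x t - x s| < e.
Proof.
move=> H /H[d d0 {}H]; exists d => // s t a_s st tb std.
have := H 1%N (fun=> s) (fun=> t); rewrite !big_ord1; apply => //.
by move=> i j _ _ _; rewrite (ord1 i) (ord1 j).
Qed.

(* If [z = sup x(t) / t] exceeded [V], then near a time [t1] where [x(t1) / t1] is
   almost [z] the slope of [x] is at most [z - k], so going back from [t1] to
   [t1 / 2] the ratio [x(t) / t] rises above [z]. *)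
Lemma filippov_barrier (x : R -> R) (V K : R) :
  (forall T, abs_continuous 0 T x) -> x 0 = 0 ->
  {ae mu, forall t, 0 < t -> derivable x t 1 /\ derive1 x t <= K} ->
  (forall xi, V < xi -> exists2 k : R, 0 < k &
    {ae mu, forall t, 0 < t -> xi * t < x t ->
       derivable x t 1 /\ derive1 x t <= x t / t - k}) ->
  forall t, 0 <= t -> x t <= V * t.
Proof.
move=> acx x0 xK xV t0; rewrite le_eqVlt => /predU1P[<-|t00].
  by rewrite x0 mulr0.
rewrite leNgt; apply/negP => Vx.
pose Y := [set x t / t | t in `]0, t0]%classic].
have Yt t : 0 < t -> t <= t0 -> Y (x t / t).
  by move=> ? ?; exists t; rewrite //= in_itv/=; apply/andP.
(* The slope bound [K] together with [x 0 = 0] keeps the ratio bounded above; this is what a growth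
   of the ratio towards [t = 0] would violate. *)
have Yub : has_ubound Y.
  exists K => w [t]; rewrite /= in_itv/= => /andP[t1 _] <-.
  rewrite ler_pdivrMr//.
  have := @abs_continuous_le _ 0 t K x (ltW t1) (acx t).
  rewrite x0 !subr0; apply; apply: (ae_imp _ xK) => s H /andP[s0 _]; exact: H.
have hY : has_sup Y by split => //; exists (x t0 / t0); exact: Yt.
pose z := sup Y.
have zt t : 0 < t -> t <= t0 -> x t <= z * t.
  by move=> h1 h2; rewrite -ler_pdivrMr//; exact: (ub_le_sup Yub (Yt _ h1 h2)).
have Vz : V < z.
  by rewrite -(ltr_pM2r t00); apply: lt_le_trans Vx _; exact: zt.
pose xi := (V + z) / 2.
have Vxi : V < xi by rewrite /xi; lra.
have xiz : xi < z by rewrite /xi; lra.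
have [k k0 Hk] := xV _ Vxi.
(* Going back to [t1 / 2] gains [k * t1 / 2], which must beat the defect [e * t1]; and the gap
   [(z - xi) * (t1 / 2)] must beat it too, so that [x] cannot meet the line of slope [xi] on the
   way. *)
pose e := Num.min (k / 4) ((z - xi) / 4).
have e0 : 0 < e by rewrite lt_min !divr_gt0// subr_gt0.
have ek : e <= k / 4 by rewrite ge_min lexx.
have exi : e <= (z - xi) / 4 by rewrite ge_min lexx orbT.
have [w0 [t1 t1Y <-]] := sup_adherent e0 hY.
move: t1Y; rewrite /= in_itv/= => /andP[t10 t1t0].
rewrite -/z ltr_pdivlMr// => xt1.
have step a : t1 / 2 <= a -> a <= t1 -> (forall t, a < t -> t < t1 -> xi * t < x t) ->
    x t1 - x a <= (z - k) * (t1 - a).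
  move=> t1a at1 H; have a0 : 0 < a by apply: lt_le_trans t1a; rewrite divr_gt0.
  apply: abs_continuous_le => //.
    by apply: abs_continuousS (acx t1) => //; exact: ltW.
  apply: (ae_imp _ Hk) => t Ht /andP[at_ tt1].
  have t_0 := lt_trans a0 at_.
  have [dt xt] := Ht t_0 (H _ at_ tt1); split => //; apply: le_trans xt _.
  rewrite lerD2r ler_pdivrMr//; apply: zt => //.
  exact: le_trans (ltW tt1) t1t0.
have low a : t1 / 2 <= a -> a <= t1 -> (forall t, a < t -> t < t1 -> xi * t < x t) ->
    z * a + k * (t1 - a) - e * t1 < x a.
  by move=> h1 h2 /(step a h1 h2) h3; lra.
have et1 : e * t1 <= k / 4 * t1 by rewrite ler_wpM2r// ltW.
have et2 : e * t1 <= (z - xi) / 4 * t1 by rewrite ler_wpM2r// ltW.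
have kt1 : 0 < k * t1 by rewrite mulr_gt0.
(* The slope estimate is valid only above the line of slope [xi]. If [x] were on or below that line
   somewhere in [[t1 / 2, t1]], take the last such time [w]: the estimate holds on []w, t1[], and
   [low] at [w] contradicts the choice of [w]. *)
have above s : t1 / 2 <= s -> s <= t1 -> xi * s < x s.
  move=> t1s st1; rewrite ltNge; apply/negP => xs.
  pose S := [set t | s <= t <= t1 /\ x t <= xi * t].
  have hS : has_sup S.
    split; first by exists s; split; rewrite // lexx st1.
    by exists t1 => t [/andP[]].
  pose w := sup S.
  have sw : s <= w by apply: (ub_le_sup hS.2); split; rewrite // lexx st1.
  have wt1 : w <= t1 by apply: ge_sup hS.1 _ => t [/andP[]].
  have xw : x w <= xi * w.
    rewrite leNgt; apply/negP => wx.
    pose g := x w - xi * w; have g0 : 0 < g by rewrite subr_gt0.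
    have s0 : 0 <= s by apply: le_trans t1s; rewrite divr_ge0// ltW.
    have g20 : 0 < g / 2 by rewrite divr_gt0.
    have [d d0 Hd] := abs_continuous_dist (acx t1) g20.
    have M0 : 0 < `|xi| + 1 by rewrite ltr_wpDl.
    pose d' := Num.min d (g / 2 / (`|xi| + 1)).
    have d'0 : 0 < d' by rewrite lt_min d0 divr_gt0.
    have [t [/andP[st tt1] xt] wt] := sup_adherent d'0 hS.
    have tw : t <= w by apply: (ub_le_sup hS.2); split; rewrite // st tt1.
    have wtd : w - t < d' by rewrite -/w in wt; lra.
    have := Hd t w (le_trans s0 st) tw wt1.
    rewrite (lt_le_trans wtd) ?ge_min ?lexx// => /(_ isT).
    have : (w - t) * (`|xi| + 1) < g / 2.
      by rewrite -ltr_pdivlMr// (lt_le_trans wtd)// ge_min lexx orbT.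
    have : - xi * (w - t) <= `|xi| * (w - t).
      by rewrite ler_wpM2r ?subr_ge0// -normrN ler_norm.
    have := ler_norm (x w - x t); rewrite /g; lra.
  have t1w : t1 / 2 <= w by exact: le_trans t1s sw.
  have := low w t1w wt1.
  have H t : w < t -> t < t1 -> xi * t < x t.
    move=> wt tt1; rewrite ltNge; apply/negP => xt.
    suff : t <= w by rewrite leNgt wt.
    apply: (ub_le_sup hS.2); split => //.
    by rewrite (le_trans sw (ltW wt)) ltW.
  move=> /(_ H).
  have : 0 <= k * (t1 - w) by rewrite mulr_ge0 ?subr_ge0// ltW.
  have : (z - xi) * (t1 / 2) <= (z - xi) * w by rewrite ler_wpM2l// subr_ge0 ltW.
  have : 0 < (z - xi) * t1 by rewrite mulr_gt0// subr_gt0.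
  lra.
have t12 : t1 / 2 <= t1 by lra.
have := low (t1 / 2) (lexx _) t12.
have H t : t1 / 2 < t -> t < t1 -> xi * t < x t.
  by move=> h1 h2; apply: above; exact: ltW.
move=> /(_ H).
have : x (t1 / 2) <= z * (t1 / 2) by apply: zt; [rewrite divr_gt0|exact: le_trans t12 t1t0].
lra.
Qed.
End barrier.

(** * Null sets of a product and iterated integrals *)

Section sections.
Context d1 d2 (T1 : measurableType d1) (T2 : measurableType d2) (R : realType).
Variables (m1 : {sigma_finite_measure set T1 -> \bar R})
          (m2 : {sigma_finite_measure set T2 -> \bar R}).

Lemma product_measure_ysection (N : set (T1 * T2)) : measurable N ->
  ((m1 \x m2) N = \int[m2]_y m1 (ysection N y))%E.
Proof.
move=> mN; have mf : measurable_fun setT (EFin \o \1_N : T1 * T2 -> \bar R).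
  exact/measurable_EFinP.
rewrite -[in LHS](setIT N) -(integral_indic _ measurableT mN).
rewrite (fubini_tonelli2 _ mf) => [|p]; last by rewrite lee_fin.
by rewrite (indic_fubini_tonelli_GE m1 mN).
Qed.

Lemma ae_ysection (P : T1 * T2 -> Prop) : {ae (m1 \x m2)%E, forall p, P p} ->
  {ae m2, forall y, {ae m1, forall x, P (x, y)}}.
Proof.
move=> [N [mN N0 PN]]; have mG := measurable_fun_ysection m1 mN.
have G0 : (\int[m2]_y `|m1 (ysection N y)| = 0)%E.
  rewrite -[RHS]N0 product_measure_ysection//.
  by apply: eq_integral => y _; rewrite gee0_abs.
have /(ae_eq_integral_abs _ measurableT mG) [M [mM M0 GM]] := G0.
exists M; split => // y nPy; apply: GM => /= /(_ I) Gy; apply: nPy.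
exists (ysection N y); split; [exact: measurable_ysection|exact: Gy|].
by move=> x nP; apply/ysectionP; exact: PN.
Qed.

(** [weak_form] nests two real integrals, each passing through [fine], and the sign of [F] is known
    only almost everywhere. A clamped copy of [- F], nonnegative and bounded everywhere, is put in
    place of [F] so that Tonelli's theorem applies; its integral is then both nonnegative and
    nonpositive. *)
Lemma ae_eq0_iterated_integral (F : T1 * T2 -> R) (D : set T2) B1 B2 (C : R) :
  measurable D -> measurable B1 -> measurable B2 ->
  (m1 B1 < +oo)%E -> (m2 B2 < +oo)%E -> 0 <= C ->
  measurable_fun (setT `*` D) F ->
  (forall p, D p.2 -> ~ (B1 p.1 /\ B2 p.2) -> F p = 0) ->
  {ae (m1 \x m2)%E, forall p, D p.2 -> - C <= F p <= 0} ->
  0 <= \int[m2]_(y in D) (\int[m1]_(x in setT) F (x, y)) ->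
  {ae (m1 \x m2)%E, forall p, D p.2 -> F p = 0}.
Proof.
move=> mD mB1 mB2 B1oo B2oo C0 mF FB FC F0.
have mS : measurable (setT `*` D : set (T1 * T2)) by exact: measurableX.
pose F' := F \_ (setT `*` D).
have mF' : measurable_fun setT F' by apply/(measurable_restrict _ mS measurableT); rewrite setTI.
(* [N] lies in [[0, C]] at every point and agrees with [- F'] almost everywhere. *)
pose N p := Num.min C (Num.max 0 (- F' p)).
have mN : measurable_fun setT N.
  apply: measurable_minr; first exact: measurable_cst.
  apply: measurable_maxr; first exact: measurable_cst.
  exact: measurableT_comp mF'.
have N0 p : 0 <= N p by rewrite le_min C0/= le_max lexx.
have NC p : N p <= C by rewrite ge_min lexx.
have F'E p : D p.2 -> F' p = F p.
  by move=> Dp; rewrite /F' patchE mem_set.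
have F'E0 p : ~ D p.2 -> F' p = 0.
  by move=> Dp; rewrite /F' patchE memNset// => -[].
have NB p : ~ (B1 p.1 /\ B2 p.2) -> N p = 0.
  move=> pB; have -> : N p = Num.min C (Num.max 0 0).
    rewrite /N; congr (Num.min _ (Num.max _ _)).
    have [Dp|Dp] := pselect (D p.2); last by rewrite F'E0// oppr0.
    by rewrite F'E// FB// oppr0.
  by rewrite maxxx; apply/min_idPr.
have ND p : ~ D p.2 -> N p = 0.
  by move=> Dp; rewrite /N F'E0// oppr0 maxxx; apply/min_idPr.
have FN : {ae (m1 \x m2)%E, forall p, F' p = - N p}.
  move: FC => [Z [mZ Z0 sZ]]; exists Z; split => // p np; apply: sZ => H; apply: np => /=.
  have [Dp|Dp] := pselect (D p.2); last by rewrite ND// F'E0// oppr0.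
  move: (H Dp); rewrite /N F'E// => /andP[CF Fp0].
  rewrite max_r ?oppr_ge0// min_r ?opprK//; lra.
have mNE : measurable_fun setT (EFin \o N) by exact/measurable_EFinP.
have mFE : measurable_fun setT (EFin \o F') by exact/measurable_EFinP.
have N0E p : (0 <= (EFin \o N) p)%E by rewrite lee_fin.
pose g := fubini_G m1 (EFin \o N).
have mg : measurable_fun setT g := measurable_fun_fubini_tonelli_G (m1 := m1) _ mNE N0E.
have g0 y : (0 <= g y)%E by exact: integral_ge0.
(* The finite measure of the box makes [g] finite at every [y], so that [fine] loses nothing. *)
pose K := (C%:E * m1 B1)%E.
have gK y : (g y <= K * (\1_B2 y)%:E)%E.
  have sect : measurable_fun setT (fun x => (N (x, y))%:E).
    exact: (measurable_fun_pair1 _ mNE).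
  have [yB|yB] := pselect (B2 y).
    rewrite indicE mem_set// mule1 /K -(setIT B1) -(integral_indic _ measurableT mB1).
    rewrite -ge0_integralZl_EFin//; last by apply/measurable_EFinP.
    apply: ge0_le_integral => //.
    - by apply/measurable_EFinP/measurable_funM => //.
    - move=> x _; rewrite /= -EFinM lee_fin indicE.
      have [xB|xB] := pselect (B1 x); first by rewrite mem_set// mulr1.
      by rewrite NB ?mulr_ge0// => -[].
  rewrite indicE memNset// mule0 /g /fubini_G integral0_eq// => x _.
  by rewrite /= NB// => -[].
have Koo : (K < +oo)%E by rewrite lte_mul_pinfty.
have K0 : (0 <= K)%E by rewrite mule_ge0.
have goo y : (g y < +oo)%E.
  apply: le_lt_trans (gK y) _; rewrite indicE.
  by case: (_ \in _); rewrite ?mule1// mule0.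
have gfin y : g y \is a fin_num by rewrite ge0_fin_numE.
(* [F'] need not have a sign on every section, so the measurability of [G] is obtained from its
   positive and negative parts. *)
pose G y := (\int[m1]_x (F' (x, y))%:E)%E.
have mG : measurable_fun setT G.
  have -> : G = fun y => (fubini_G m1 (EFin \o F')^\+%E y - fubini_G m1 (EFin \o F')^\-%E y)%E.
    apply/funext => y; rewrite /G integralE.
    by congr (_ - _)%E; apply: eq_integral => x _; rewrite ?funeposE ?funenegE.
  apply: emeasurable_funB; apply: measurable_fun_fubini_tonelli_G => //.
    exact: measurable_funepos.
  exact: measurable_funeneg.
have Gg : {ae m2, forall y, G y = (- g y)%E}.
  have [Z [mZ Z0 sZ]] := ae_ysection FN.
  exists Z; split => // y ny; apply: sZ => H; apply: ny => /=.
  rewrite /g /fubini_G -integral_ge0N//.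
  apply: ae_eq_integral => //.
  - exact: (measurable_fun_pair1 _ mFE).
  - by apply: measurableT_comp => //; exact: (measurable_fun_pair1 _ mNE).
  - case: H => [W [mW W0 sW]]; exists W; split => // x nx; apply: sW => Hx; apply: nx.
    by move=> _ /=; rewrite Hx EFinN.
have intg : (\int[m2]_(y in D) g y = 0)%E.
  have E : (\int[m2]_(y in D) (Rintegral m1 setT (fun x => F (x, y)))%:E =
           - \int[m2]_(y in D) g y)%E.
    rewrite -integral_ge0N//.
    transitivity (\int[m2]_(y in D) (fine (G y))%:E)%E.
      apply: eq_integral => y /set_mem Dy; congr (EFin (fine _)).
      by apply: eq_integral => x _; rewrite F'E.
    apply: ae_eq_integral => //.
    - apply/measurable_EFinP; apply: measurable_funTS.
      by apply: measurableT_comp mG; exact: fine_measurable.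
    - by apply: measurable_funTS; apply: measurableT_comp.
    - case: Gg => [W [mW W0 sW]]; exists W; split => // x nx; apply: sW => Hx; apply: nx.
      by move=> _ /=; rewrite Hx fineK// fin_numN.
  have gint : (\int[m2]_(y in D) g y < +oo)%E.
    apply: (@le_lt_trans _ _ (\int[m2]_(y in D) (K * (\1_B2 y)%:E))%E).
      apply: ge0_le_integral => //.
      - exact: measurable_funTS.
      - apply: measurable_funTS; apply: emeasurable_funM => //.
        exact/measurable_EFinP.
    have KE : K = (fine K)%:E by rewrite fineK// ge0_fin_numE.
    rewrite KE ge0_integralZl_EFin//; last first.
    - by rewrite fine_ge0.
    - apply: measurable_funTS; exact/measurable_EFinP.
    rewrite integral_indic// lte_mul_pinfty// ?lee_fin ?fine_ge0//.
    apply: le_lt_trans B2oo; apply: le_measure; rewrite ?inE//.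
    exact: measurableI.
  have gge0 : (0 <= \int[m2]_(y in D) g y)%E by exact: integral_ge0.
  move: F0; rewrite {1}/Rintegral E fineN.
  have gf : (\int[m2]_(y in D) g y)%E \is a fin_num by rewrite ge0_fin_numE.
  rewrite oppr_ge0 => H; apply/eqP; rewrite eq_le gge0 andbT.
  by rewrite -(fineK gf) lee_fin.
have intN : (\int[m1 \x m2]_p `|(N p)%:E| = 0)%E.
  have -> : (fun p => `|(N p)%:E|%E) = EFin \o N.
    by apply/funext => p; rewrite gee0_abs// lee_fin.
  rewrite (fubini_tonelli2 _ mNE N0E) -intg [RHS]integral_mkcond.
  apply: eq_integral => y _; rewrite patchE; case: ifPn => // /negP yD.
  rewrite /fubini_G integral0_eq// => x _; rewrite /= ND//= => Dy; apply: yD.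
  exact: mem_set.
have /(ae_eq_integral_abs _ measurableT mNE) [M [mM M0 NM]] := intN.
case: FN => [Z [mZ Z0 sZ]].
exists (M `|` Z); split; first exact: measurableU.
  by rewrite measureU0.
move=> p np; apply: contrapT => /not_orP[Mp Zp]; apply: np => Dp.
rewrite -F'E//.
have -> : F' p = - N p by apply: contrapT => H; apply: Zp; exact: sZ.
apply/eqP; rewrite oppr_eq0; apply/eqP; apply: contrapT => H; apply: Mp.
by apply: NM => /= /(_ I) [].
Qed.
End sections.

(** * Entropies vanishing on a cone *)

Section cone_vanishing.
Context {R : realType}.
Local Notation mu := (@lebesgue_measure R).
Local Notation S := (setT `*` `[0, +oo[%classic : set (measurableTypeR R * measurableTypeR R)).

Lemma measurable_bump_affine (P : {poly R}) (a b d : R)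
    (D : set (measurableTypeR R * measurableTypeR R)) :
  measurable_fun D (fun p => bump P (a * p.1 + b * p.2 + d)).
Proof.
apply: measurable_funTS; apply: (@measurableT_comp _ _ _ _ _ _ (bump P)).
  by apply: continuous_measurable_fun; exact: continuous_bump.
apply: measurable_funD; last exact: measurable_cst.
apply: measurable_funD; apply: measurable_funM; first exact: measurable_cst.
- exact: measurable_fst.
- exact: measurable_cst.
- exact: measurable_snd.
Qed.

Lemma measurable_cone_flux (eta q : R -> R) (u : R * R -> R) (e x0 s X L T : R) :
  continuous eta -> continuous q -> measurable_fun S u ->
  measurable_fun S (fun p => cone_flux e x0 s X L T (eta (u p)) (q (u p)) p).
Proof.
move=> ceta cq mu_; rewrite /cone_flux.
have mb := @measurable_bump_affine.
have mc (k : R) : measurable_fun S (fun=> k) by exact: measurable_cst.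
apply: measurable_funD; apply: measurable_funM.
- apply: (@measurableT_comp _ _ _ _ _ _ eta) => //.
  exact: continuous_measurable_fun.
- rewrite (funext (dt_cone_test e x0 s X L T)).
  by repeat (first [exact: mc | exact: mb | apply: measurable_funB |
    apply: measurable_funD | apply: measurable_funM]).
- apply: (@measurableT_comp _ _ _ _ _ _ q) => //.
  exact: continuous_measurable_fun.
- rewrite (funext (dx_cone_test e x0 s X L T)).
  by repeat (first [exact: mc | exact: mb | apply: measurable_funB |
    apply: measurable_funD | apply: measurable_funM]).
Qed.

(** The sign of [cone_flux] and the entropy inequality force the integrand to vanish almost
    everywhere, and the equality case of [cone_flux_le0] then gives the conclusion. The set [J]
    holds the values known to be taken by [u], so the structural inequalities are required only
    there. *)
Lemma cone_vanishing (eta q u0 : R -> R) (u : R * R -> R) (e x0 s L M : R) (J : set R) :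
  e = 1 \/ e = -1 -> measurable_fun S u -> continuous eta -> continuous q ->
  {ae (mu \x mu)%E, forall p, 0 <= p.2 -> J (u p)} ->
  (forall v, J v -> `|eta v| <= M /\ `|q v| <= M) ->
  (forall v, J v -> [/\ 0 <= eta v, e * q v <= e * s * eta v & `|q v| <= L * eta v]) ->
  (forall x, x != 0 -> 0 < e * (x - x0) -> eta (u0 x) = 0) ->
  (forall X T, 0 <= weak_form eta q u0 u (cone_test e x0 s X L T)) ->
  {ae (mu \x mu)%E, forall p, 0 <= p.2 -> 0 < e * (p.1 - x0 - s * p.2) -> eta (u p) = 0}.
Proof.
move=> e1 mu_ ceta cq uJ JM Jq eta0 wf.
(* The truncations [X = T = n] exhaust the cone, and countably many null sets are discarded. *)
suff H n : {ae (mu \x mu)%E, forall p : R * R, 0 <= p.2 -> 0 < cone1 e x0 s p ->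
    0 < cone2 e n%:R L p -> 0 < cone3 n%:R p -> eta (u p) = 0}.
  have := ae_foralln H; move=> [Z [mZ Z0 sZ]]; exists Z; split => // p np; apply: sZ => Hp.
  apply: np => p0 pc.
  pose k := `|p.1| + `|L| * p.2 + p.2.
  have ep : e * p.1 <= `|p.1|.
    by case: e1 => ->; rewrite ?mul1r ?mulN1r ?ler_norm// -normrN ler_norm.
  have Lp : - (L * p.2) <= `|L| * p.2.
    by rewrite -mulNr ler_wpM2r// -normrN ler_norm.
  have Lp' : L * p.2 <= `|L| * p.2 by rewrite ler_wpM2r// ler_norm.
  have Lp0 : 0 <= `|L| * p.2 by rewrite mulr_ge0.
  have p10 := normr_ge0 p.1.
  have kn : k < (Num.truncn k).+1%:R by exact: truncnS_gt.
  apply: (Hp (Num.truncn k).+1) => //.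
  - by move: pc; rewrite /cone1; lra.
  - by rewrite /cone2; move: kn; rewrite {1}/k; lra.
  - by rewrite /cone3; move: kn; rewrite {1}/k; lra.
have [C C0 HC] := @cone_flux_bound R e x0 s n%:R L n%:R M.
pose F p := cone_flux e x0 s n%:R L n%:R (eta (u p)) (q (u p)) p.
have mI (a b : R) : measurable (`[a, b]%classic : set (measurableTypeR R)) by [].
pose r := cone_radius x0 s n%:R L n%:R.
pose B1 := `[- r, r]%classic; pose B2 := `[- (`|n%:R| + 1), `|n%:R : R| + 1]%classic.
have B1E p : B1 p = (`|p| <= r) :> Prop by rewrite /B1 /= in_itv/= ler_norml.
have B2E p : B2 p = (`|p| <= `|n%:R| + 1) :> Prop by rewrite /B2 /= in_itv/= ler_norml.
have fin (a b : R) : (mu `[a, b]%classic < +oo)%E.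
  by rewrite lebesgue_measure_itv/=; case: ifP => _; rewrite ?ltry// -EFinB ltry.
have FF : {ae (mu \x mu)%E, forall p, `[0, +oo[%classic p.2 -> F p = 0}.
  apply: (@ae_eq0_iterated_integral _ _ (measurableTypeR R) (measurableTypeR R) R
    mu mu F `[0, +oo[%classic B1 B2 C) => //.
  - exact: mI.
  - exact: mI.
  - exact: fin.
  - exact: fin.
  - exact: measurable_cone_flux.
  - move=> p _; rewrite B1E B2E => H; apply: cone_flux_eq0 => //.
    by rewrite -negb_and; apply/negP => /andP.
  - case: uJ => Z [mZ Z0 sZ]; exists Z; split => // p np; apply: sZ => Jp; apply: np.
    rewrite /= in_itv/= andbT => p0; have {}Jp := Jp p0.
    have [eM qM] := JM _ Jp; have [h1 h2 h3] := Jq _ Jp.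
    have [-> _] := cone_flux_le0 x0 n%:R n%:R e1 h1 h2 h3 p0.
    by rewrite andbT; have := HC _ _ p eM qM; rewrite ler_norml => /andP[].
  - have := wf n%:R n%:R; rewrite /weak_form.
    have -> : Rintegral mu setT (fun x => eta (u0 x) * cone_test e x0 s n%:R L n%:R (x, 0)) = 0.
      (* The value of [u0] at 0 is not prescribed. Everywhere else either the entropy of the data or
         the test function vanishes, so the initial term lives on a single point. *)
      pose c0 := eta (u0 0) * cone_test e x0 s n%:R L n%:R (0, 0).
      have -> : (fun x => eta (u0 x) * cone_test e x0 s n%:R L n%:R (x, 0)) =
          (fun x => c0 * \1_[set 0] x).
        apply/funext => x; rewrite indicE; have [->|xn0] := eqVneq x 0.
          by rewrite mem_set// mulr1.
        rewrite memNset ?mulr0; last by move=> /= x_0; rewrite x_0 eqxx in xn0.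
        have [x_|x_] := ltP 0 (e * (x - x0)); first by rewrite eta0// mul0r.
        by rewrite /cone_test bump1_eq0 ?mul0r ?mulr0// /cone1/=; lra.
      rewrite /Rintegral (@ae_eq_integral _ (measurableTypeR R) R mu setT (cst 0%E)) ?integral0//.
        by apply/measurable_EFinP; apply: measurable_funM => //; exact: measurable_indic.
      exists [set 0]; split => //; first exact: lebesgue_measure_set1.
      move=> x /= nx; apply: contrapT => xn0; apply: nx => _.
      by rewrite indicE memNset// mulr0.
    by rewrite addr0.
case: (uJ) => Z [mZ Z0 sZ]; case: FF => Z' [mZ' Z0' sZ'].
exists (Z `|` Z'); split; first exact: measurableU.
  by rewrite measureU0.
move=> p np; apply: contrapT => /not_orP[Zp Zp']; apply: np => p0 c1 c2 c3.
have Jp : J (u p).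
  by apply: contrapT => nJ; apply: Zp; apply: sZ => /= /(_ p0).
have Fp : F p = 0.
  by apply: contrapT => nF; apply: Zp'; apply: sZ' => /=; rewrite in_itv/= p0 => /(_ isT).
have [h1 h2 h3] := Jq _ Jp.
have [_ H] := cone_flux_le0 x0 n%:R n%:R e1 h1 h2 h3 p0.
exact: H.
Qed.
End cone_vanishing.

(** * Kruzkov half-entropies of a C1 flux *)

Section entropies.
Context {R : realType}.
Local Notation mu := (@lebesgue_measure R).
Implicit Types (f : R -> R) (k v w : R).

Lemma convex_functionP (D : set R) (f : R -> R) :
  convex_function D f <-> forall t x y : R, 0 <= t -> t <= 1 -> D x -> D y ->
    f (t * x + (1 - t) * y) <= t * f x + (1 - t) * f y.
Proof.
split=> [cf t x y t0 t1 Dx Dy|cf t x y /set_mem Dx /set_mem Dy].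
  have t01 : Itv.spec (@Itv.num_sem R) (Itv.Real `[0%Z, 1%Z]) t.
    by rewrite /= /Itv.num_sem/= in_itv/= t0 t1 num_real.
  have := cf (Itv.mk t01) x y (mem_set Dx) (mem_set Dy).
  by rewrite !convRE.
rewrite !convRE; apply: cf => //.
Qed.

Lemma C1_is_derive f v : C1 f -> is_derive v 1 f (derive1 f v).
Proof. by move=> [df _]; rewrite derive1E; exact/derivableP. Qed.

Lemma C1_continuous f : C1 f -> continuous f.
Proof.
by move=> [df _] v; apply: differentiable_continuous; exact/derivable1_diffP.
Qed.

Lemma C1_mvt f v w : C1 f -> v <= w -> exists2 z, v <= z <= w & f w - f v = derive1 f z * (w - v).
Proof.
move=> Cf vw; have [z zvw E] := @MVT_segment R f (derive1 f) v w vw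
  (fun x _ => C1_is_derive x Cf) (continuous_subspaceT (C1_continuous Cf)).
by exists z => //; rewrite in_itv in zvw.
Qed.

Lemma C1_lipschitz f (r : R) : C1 f -> exists2 L : R, 0 <= L &
  forall v w, - r <= v <= r -> - r <= w <= r -> `|f v - f w| <= L * `|v - w|.
Proof.
move=> Cf; have [r0|r0] := ltP r 0.
  by exists 0 => // v w /andP[h1 h2]; lra.
have rr : - r <= r by lra.
have cd : {within `[- r, r], continuous (fun x => `|derive1 f x|)}.
  apply: continuous_subspaceT => x; apply: cvg_norm; exact: Cf.2.
have [z _ Hz] := EVT_max rr cd.
exists `|derive1 f z| => // v w; wlog vw : v w / v <= w => [H|] hv hw.
  have [/H|/ltW/H] := leP v w; first exact.
  by rewrite distrC (distrC v); apply.
have [y yvw E] := C1_mvt Cf vw.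
rewrite distrC E normrM (distrC w) ler_wpM2r//; apply: Hz.
rewrite in_itv/=; lra.
Qed.

Lemma C1_locally_lipschitz f (p : R -> R) k :
  C1 f -> (forall v w, `|p v - p w| <= `|v - w|) -> p k = k ->
  locally_lipschitz (fun v => f (p v)).
Proof.
move=> Cf pl pk r.
(* As [p] is 1-Lipschitz and fixes [k], [|p x| <= |x - k| + |k| <= |x| + 2 |k|]. *)
have [L L0 HL] := C1_lipschitz (`|r| + 2 * `|k|) Cf.
exists L; split; first exact: num_real.
move=> M LM [v w] /= []; rewrite !in_itv/= => vr wr.
have rn := ler_norm r.
have pb x : - r <= x <= r -> - (`|r| + 2 * `|k|) <= p x <= `|r| + 2 * `|k|.
  move=> xr; rewrite -ler_norml.
  have := pl x k; rewrite pk => h.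
  have h1 := ler_normB (p x - k) (- k); rewrite opprK subrK normrN in h1.
  have h2 := ler_normB x k.
  have : `|x| <= `|r| by rewrite (le_trans _ rn)// ler_norml.
  lra.
apply: le_trans (HL _ _ (pb _ vr) (pb _ wr)) _.
apply: ler_pM => //; exact: ltW.
Qed.

(** Writing the positive parts through [max] and [min] turns each flux into [f] composed with a
    1-Lipschitz truncation fixing [k], up to sign and a constant; continuity and the Lipschitz bound
    follow without cases. *)
Definition eta_above k v := Num.max v k - k.
Definition flux_above f k v := f (Num.max v k) - f k.
Definition eta_below k v := k - Num.min v k.
Definition flux_below f k v := f k - f (Num.min v k).

Lemma lipschitz_shift (p : R -> R) (c : R) :
  locally_lipschitz p -> locally_lipschitz (fun v => p v - c).
Proof.
move=> H r; have [M0 [M0r HM0]] := H r; exists M0; split => // M /HM0 HM [v w] vw.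
by have := HM (v, w) vw => /=; rewrite opprB addrA subrK.
Qed.

Lemma lipschitz_opp_shift (p : R -> R) (c : R) :
  locally_lipschitz p -> locally_lipschitz (fun v => c - p v).
Proof.
move=> H r; have [M0 [M0r HM0]] := H r; exists M0; split => // M /HM0 HM [v w] vw.
rewrite /=; have -> : c - p v - (c - p w) = p w - p v by ring.
by have := HM (v, w) vw => /=; rewrite distrC.
Qed.

Lemma ae_neq k (P : R -> Prop) : (forall v, v != k -> P v) -> {ae mu, forall v, P v}.
Proof.
move=> H; exists [set k]; split => //; first exact: lebesgue_measure_set1.
by move=> v /= nP; apply/eqP/negPn/negP => /H.
Qed.

(** Away from [v = k], a null set, entropy and flux locally are either both zero or translates of
    the identity and of [f]. *)
Lemma entropy_pair_above f k : C1 f -> entropy_pair f (eta_above k) (flux_above f k).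
Proof.
move=> Cf; split.
- apply/convex_functionP => t x y t0 t1 _ _; rewrite /eta_above.
  have h1 : x <= Num.max x k by rewrite le_max lexx.
  have h2 : k <= Num.max x k by rewrite le_max lexx orbT.
  have h3 : y <= Num.max y k by rewrite le_max lexx.
  have h4 : k <= Num.max y k by rewrite le_max lexx orbT.
  have t1' : 0 <= 1 - t by lra.
  have := ler_wpM2l t0 h1; have := ler_wpM2l t0 h2.
  have := ler_wpM2l t1' h3; have := ler_wpM2l t1' h4.
  rewrite [Num.max (_ + _) k]maxEle; case: ifP => _; lra.
- apply: lipschitz_shift.
  apply: (@C1_locally_lipschitz f (fun v => Num.max v k) k Cf); last by rewrite maxxx.
  move=> v w; have := ler_norm (v - w); have := ler_norm (w - v); rewrite distrC.
  by rewrite ler_norml !maxEle; case: (leP v k) => h1; case: (leP w k) => h2; lra.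
- apply: (@ae_neq k) => v; rewrite neq_lt => /orP[vk|kv].
    have dE : is_derive v 1 (eta_above k) 0.
      apply: (near_eq_is_derive _ (is_derive_cst (0 : R) v 1)).
      near=> x; rewrite /eta_above max_r ?subrr//; apply: ltW; near: x; exact: lt_nbhsl.
    have dF : is_derive v 1 (flux_above f k) 0.
      apply: (near_eq_is_derive _ (is_derive_cst (0 : R) v 1)).
      near=> x; rewrite /flux_above max_r ?subrr//; apply: ltW; near: x; exact: lt_nbhsl.
    by split; [exact: ex_derive|rewrite derive1E derive_val mul0r].
  have dE : is_derive v 1 (eta_above k) 1.
    have := is_deriveB (is_derive_id v 1) (is_derive_cst k v 1); rewrite subr0.
    apply: near_eq_is_derive.
    near=> x; rewrite /eta_above max_l//; apply: ltW; near: x; exact: lt_nbhsr.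
  have dF : is_derive v 1 (flux_above f k) (derive1 f v).
    have := is_deriveB (C1_is_derive v Cf) (is_derive_cst (f k) v 1); rewrite subr0.
    apply: near_eq_is_derive.
    near=> x; rewrite /flux_above max_l//; apply: ltW; near: x; exact: lt_nbhsr.
  by split; [exact: ex_derive|rewrite (derive1E (eta_above k)) derive_val mul1r].
Unshelve. all: by end_near. Qed.

Lemma entropy_pair_below f k : C1 f -> entropy_pair f (eta_below k) (flux_below f k).
Proof.
move=> Cf; split.
- apply/convex_functionP => t x y t0 t1 _ _; rewrite /eta_below.
  have h1 : Num.min x k <= x by rewrite ge_min lexx.
  have h2 : Num.min x k <= k by rewrite ge_min lexx orbT.
  have h3 : Num.min y k <= y by rewrite ge_min lexx.
  have h4 : Num.min y k <= k by rewrite ge_min lexx orbT.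
  have t1' : 0 <= 1 - t by lra.
  have := ler_wpM2l t0 h1; have := ler_wpM2l t0 h2.
  have := ler_wpM2l t1' h3; have := ler_wpM2l t1' h4.
  rewrite [Num.min (_ + _) k]minEle; case: ifP => _; lra.
- apply: lipschitz_opp_shift.
  apply: (@C1_locally_lipschitz f (fun v => Num.min v k) k Cf); last by rewrite minxx.
  move=> v w; have := ler_norm (v - w); have := ler_norm (w - v); rewrite distrC.
  by rewrite ler_norml !minEle; case: (leP v k) => h1; case: (leP w k) => h2; lra.
- apply: (@ae_neq k) => v; rewrite neq_lt => /orP[vk|kv].
    have dE : is_derive v 1 (eta_below k) (-1).
      have := is_deriveB (is_derive_cst k v 1) (is_derive_id v 1); rewrite sub0r.
      apply: near_eq_is_derive.
      near=> x; rewrite /eta_below min_l//; apply: ltW; near: x; exact: lt_nbhsl.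
    have dF : is_derive v 1 (flux_below f k) (- derive1 f v).
      have := is_deriveB (is_derive_cst (f k) v 1) (C1_is_derive v Cf); rewrite sub0r.
      apply: near_eq_is_derive.
      near=> x; rewrite /flux_below min_l//; apply: ltW; near: x; exact: lt_nbhsl.
    by split; [exact: ex_derive|rewrite (derive1E (eta_below k)) derive_val mulN1r].
  have dE : is_derive v 1 (eta_below k) 0.
    apply: (near_eq_is_derive _ (is_derive_cst (0 : R) v 1)).
    near=> x; rewrite /eta_below min_r ?subrr//; apply: ltW; near: x; exact: lt_nbhsr.
  have dF : is_derive v 1 (flux_below f k) 0.
    apply: (near_eq_is_derive _ (is_derive_cst (0 : R) v 1)).
    near=> x; rewrite /flux_below min_r ?subrr//; apply: ltW; near: x; exact: lt_nbhsr.
  by split; [exact: ex_derive|rewrite derive1E derive_val mul0r].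
Unshelve. all: by end_near. Qed.
End entropies.

(** * Comparison with constants and the maximum principle *)

Section comparison.
Context {R : realType}.
Local Notation mu := (@lebesgue_measure R).
Local Notation S := (setT `*` `[0, +oo[%classic : set (measurableTypeR R * measurableTypeR R)).
Variables (f u0 : R -> R) (u : R * R -> R).
Hypothesis Cf : C1 f.
Hypothesis mu_ : measurable_fun S u.
Hypothesis entropy_ineq : forall eta q phi, entropy_pair f eta q -> test_function phi ->
  (forall x t, 0 <= t -> 0 <= phi (x, t)) -> 0 <= weak_form eta q u0 u phi.

Lemma continuous_maxl (k : R) : continuous (fun v : R => Num.max v k).
Proof.
rewrite (_ : (fun v => _) = fun v => (v + k + `|v - k|) / 2); last first.
  by apply/funext => v; rewrite maxr_absE.
move=> v; apply: cvgMl; apply: cvgD.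
  by apply: cvgD; [exact: cvg_id|exact: cvg_cst].
by apply: cvg_norm; apply: cvgB; [exact: cvg_id|exact: cvg_cst].
Qed.

Lemma continuous_minl (k : R) : continuous (fun v : R => Num.min v k).
Proof.
rewrite (_ : (fun v => _) = fun v => (v + k - `|v - k|) / 2); last first.
  by apply/funext => v; rewrite minr_absE.
move=> v; apply: cvgMl; apply: cvgB.
  by apply: cvgD; [exact: cvg_id|exact: cvg_cst].
by apply: cvg_norm; apply: cvgB; [exact: cvg_id|exact: cvg_cst].
Qed.

(** For the entropy [(k - v)^+] the edge condition of [cone_vanishing] is exactly the last
    hypothesis when [v <= k], and trivial when [v > k]. The outer edge moves at a Lipschitz constant
    of [f] on a ball containing [lo], [hi] and [k]. *)
Lemma comparison_below (e x0 s k lo hi : R) : e = 1 \/ e = -1 ->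
  {ae (mu \x mu)%E, forall p, 0 <= p.2 -> lo <= u p <= hi} ->
  (forall x, x != 0 -> 0 < e * (x - x0) -> k <= u0 x) ->
  (forall v, lo <= v <= hi -> v <= k -> e * (f k - f v) <= e * s * (k - v)) ->
  {ae (mu \x mu)%E, forall p, 0 <= p.2 -> 0 < e * (p.1 - x0 - s * p.2) -> k <= u p}.
Proof.
move=> e1 uJ ku0 Hf.
pose r := `|lo| + `|hi| + `|k|.
have [L L0 HL] := C1_lipschitz r Cf.
have lo1 := ler_norm lo; have lo2 := ler_norm (- lo).
have hi1 := ler_norm hi; have hi2 := ler_norm (- hi).
have k1 := ler_norm k; have k2 := ler_norm (- k).
rewrite !normrN in lo2 hi2 k2.
have n1 := normr_ge0 lo; have n2 := normr_ge0 hi; have n3 := normr_ge0 k.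
have inr v : lo <= v <= hi -> - r <= v <= r by move=> vJ; rewrite /r; lra.
have kr : - r <= k <= r by rewrite /r; lra.
have etab v : lo <= v <= hi ->
    0 <= eta_below k v <= 2 * r /\ `|flux_below f k v| <= L * eta_below k v.
  move=> vJ; have vr := inr _ vJ; rewrite /eta_below /flux_below minEle.
  case: (leP v k) => vk; last by rewrite !subrr normr0 mulr0 lexx; split => //; rewrite /r; lra.
  split; first lra.
  by have := HL _ _ kr vr; rewrite (ger0_norm (_ : 0 <= k - v)) // subr_ge0.
have := @cone_vanishing R (eta_below k) (flux_below f k) u0 u e x0 s L (2 * r + L * (2 * r))
  [set v | lo <= v <= hi] e1 mu_.
have ceta : continuous (eta_below k).
  by move=> v; apply: cvgB; [exact: cvg_cst|exact: continuous_minl].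
have cq : continuous (flux_below f k).
  move=> v; apply: cvgB; first exact: cvg_cst.
  apply: (@continuous_comp _ _ _ (fun v => Num.min v k) f); first exact: continuous_minl.
  exact: C1_continuous.
move=> /(_ ceta cq uJ) H.
apply: (ae_imp _ (H _ _ _ _)).
- move=> p Hp p0 pc; have := Hp p0 pc; rewrite /eta_below minEle.
  by case: (leP (u p) k) => // h; lra.
- move=> v /etab[/andP[h1 h2] h3].
  have h4 : L * eta_below k v <= L * (2 * r) by rewrite ler_wpM2l.
  have : 0 <= L * (2 * r) by rewrite mulr_ge0// (le_trans h1).
  rewrite ger0_norm//; lra.
- move=> v vJ; have [/andP[h1 _] h3] := etab v vJ; split => //.
  rewrite /flux_below /eta_below minEle; case: (leP v k) => vk; first exact: Hf.
  by rewrite !subrr !mulr0.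
- by move=> x x_0 /(ku0 _ x_0) h; rewrite /eta_below min_r// subrr.
- move=> X T; apply: entropy_ineq.
  + exact: entropy_pair_below.
  + exact: cone_test_test.
  + by move=> x t _; exact: cone_test_ge0.
Qed.

Lemma comparison_above (e x0 s k lo hi : R) : e = 1 \/ e = -1 ->
  {ae (mu \x mu)%E, forall p, 0 <= p.2 -> lo <= u p <= hi} ->
  (forall x, x != 0 -> 0 < e * (x - x0) -> u0 x <= k) ->
  (forall v, lo <= v <= hi -> k <= v -> e * (f v - f k) <= e * s * (v - k)) ->
  {ae (mu \x mu)%E, forall p, 0 <= p.2 -> 0 < e * (p.1 - x0 - s * p.2) -> u p <= k}.
Proof.
move=> e1 uJ ku0 Hf.
pose r := `|lo| + `|hi| + `|k|.
have [L L0 HL] := C1_lipschitz r Cf.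
have lo1 := ler_norm lo; have lo2 := ler_norm (- lo).
have hi1 := ler_norm hi; have hi2 := ler_norm (- hi).
have k1 := ler_norm k; have k2 := ler_norm (- k).
rewrite !normrN in lo2 hi2 k2.
have n1 := normr_ge0 lo; have n2 := normr_ge0 hi; have n3 := normr_ge0 k.
have inr v : lo <= v <= hi -> - r <= v <= r by move=> vJ; rewrite /r; lra.
have kr : - r <= k <= r by rewrite /r; lra.
have etab v : lo <= v <= hi ->
    0 <= eta_above k v <= 2 * r /\ `|flux_above f k v| <= L * eta_above k v.
  move=> vJ; have vr := inr _ vJ; rewrite /eta_above /flux_above maxEle.
  case: (leP v k) => vk; first by rewrite !subrr normr0 mulr0 lexx; split => //; rewrite /r; lra.
  split; first lra.
  by have := HL _ _ vr kr; rewrite (ger0_norm (_ : 0 <= v - k)) // subr_ge0 ltW.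
have := @cone_vanishing R (eta_above k) (flux_above f k) u0 u e x0 s L (2 * r + L * (2 * r))
  [set v | lo <= v <= hi] e1 mu_.
have ceta : continuous (eta_above k).
  by move=> v; apply: cvgB; [exact: continuous_maxl|exact: cvg_cst].
have cq : continuous (flux_above f k).
  move=> v; apply: cvgB; last exact: cvg_cst.
  apply: (@continuous_comp _ _ _ (fun v => Num.max v k) f); first exact: continuous_maxl.
  exact: C1_continuous.
move=> /(_ ceta cq uJ) H.
apply: (ae_imp _ (H _ _ _ _)).
- move=> p Hp p0 pc; have := Hp p0 pc; rewrite /eta_above maxEle.
  by case: (leP (u p) k) => // h; lra.
- move=> v /etab[/andP[h1 h2] h3].
  have h4 : L * eta_above k v <= L * (2 * r) by rewrite ler_wpM2l.
  have : 0 <= L * (2 * r) by rewrite mulr_ge0// (le_trans h1).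
  rewrite ger0_norm//; lra.
- move=> v vJ; have [/andP[h1 _] h3] := etab v vJ; split => //.
  rewrite /flux_above /eta_above maxEle; case: (leP v k) => vk; last by apply: Hf => //; exact: ltW.
  by rewrite !subrr !mulr0.
- by move=> x x_0 /(ku0 _ x_0) h; rewrite /eta_above max_r// subrr.
- move=> X T; apply: entropy_ineq.
  + exact: entropy_pair_above.
  + exact: cone_test_test.
  + by move=> x t _; exact: cone_test_ge0.
Qed.

(** With [s = L] a Lipschitz constant of [f], the chord condition of the two comparisons holds at
    [lo] and [hi]. The vertices [- n] move the cones leftwards until they cover the half-plane. *)
Lemma max_principle (lo hi M : R) :
  {ae (mu \x mu)%E, forall p : R * R, 0 <= p.2 -> `|u p| <= M} ->
  (forall x, x != 0 -> lo <= u0 x <= hi) ->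
  {ae (mu \x mu)%E, forall p, 0 <= p.2 -> lo <= u p <= hi}.
Proof.
move=> uM u0b.
have uJ : {ae (mu \x mu)%E, forall p, 0 <= p.2 -> - M <= u p <= M}.
  by apply: ae_imp uM => p H /H; rewrite ler_norml.
have [L L0 HL] := C1_lipschitz (`|M| + `|lo| + `|hi|) Cf.
have M1 := ler_norm M.
have lo1 := ler_norm lo; have lo2 := ler_norm (- lo).
have hi1 := ler_norm hi; have hi2 := ler_norm (- hi).
rewrite !normrN in lo2 hi2.
have n1 := normr_ge0 lo; have n2 := normr_ge0 hi.
have lip v w : - M <= v <= M -> lo = w \/ hi = w -> `|f v - f w| <= L * `|v - w|.
  by move=> vM lohi; apply: HL; [lra|case: lohi => <-; lra].
have Hlo (n : nat) : {ae (mu \x mu)%E, forall p, 0 <= p.2 ->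
    0 < 1 * (p.1 - - n%:R - L * p.2) -> lo <= u p}.
  apply: (comparison_below (or_introl erefl) uJ).
    by move=> x /u0b/andP[].
  move=> v vM vlo; rewrite !mul1r.
  have := lip v lo vM (or_introl erefl).
  rewrite distrC (distrC v) (ger0_norm (_ : 0 <= lo - v)) ?subr_ge0//.
  by move=> /(le_trans (ler_norm _)).
have Hhi (n : nat) : {ae (mu \x mu)%E, forall p, 0 <= p.2 ->
    0 < 1 * (p.1 - - n%:R - L * p.2) -> u p <= hi}.
  apply: (comparison_above (or_introl erefl) uJ).
    by move=> x /u0b/andP[].
  move=> v vM vhi; rewrite !mul1r.
  have := lip v hi vM (or_intror erefl).
  by rewrite (ger0_norm (_ : 0 <= v - hi)) ?subr_ge0// => /(le_trans (ler_norm _)).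
apply: ae_imp (ae_and (ae_foralln Hlo) (ae_foralln Hhi)) => p [H1 H2] p0.
have kn := truncnS_gt `|L * p.2 - p.1|; have kx := ler_norm (L * p.2 - p.1).
apply/andP; split.
  by apply: (H1 (Num.truncn `|L * p.2 - p.1|).+1 p0); rewrite mul1r; lra.
by apply: (H2 (Num.truncn `|L * p.2 - p.1|).+1 p0); rewrite mul1r; lra.
Qed.
End comparison.

(** * The self-similar profile *)

Section profile.
Context {R : realType}.
Local Notation mu := (@lebesgue_measure R).

Lemma ae_line (y : R) : {ae (mu \x mu)%E, forall p : R * R, p.1 <> y * p.2}.
Proof.
pose g (p : measurableTypeR R * measurableTypeR R) : R := p.1 - y * p.2.
have mg : measurable_fun setT g.
  apply: measurable_funB; first exact: measurable_fst.
  by apply: measurable_funM; [exact: measurable_cst|exact: measurable_snd].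
pose N := g @^-1` [set 0].
have mN : measurable N by rewrite -[N]setTI; apply: mg.
exists N; split => //; last first.
  by move=> p /= /contrapT E; rewrite /N /g /= E subrr.
rewrite (@product_measure_ysection _ _ (measurableTypeR R) (measurableTypeR R))//.
rewrite integral0_eq// => t _.
have -> : ysection N t = [set y * t].
  apply/seteqP; split => x /=.
    by move/ysectionP => /eqP; rewrite subr_eq0 => /eqP.
  by move=> ->; apply/ysectionP; rewrite /N /g /= subrr.
exact: lebesgue_measure_set1.
Qed.

(* The line of slope [s] through [(k, f k)] lies below the graph of [f] on [a, b]. *)
Definition slope_minimizer (f : R -> R) (a b s k : R) :=
  a <= k <= b /\ forall v, a <= v <= b -> s * (v - k) <= f v - f k.

Lemma slope_minimizer_ex (f : R -> R) (a b s : R) : C1 f -> a <= b ->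
  exists k, slope_minimizer f a b s k.
Proof.
move=> Cf ab.
have cf : {within `[a, b], continuous (fun v => f v - s * v)}.
  apply: continuous_subspaceT => v; apply: cvgB; first exact: C1_continuous.
  by apply: cvgM; [exact: cvg_cst|exact: cvg_id].
have [k + Hk] := EVT_min ab cf; rewrite in_itv/= => kab; exists k; split => // v vab.
by have := Hk v; rewrite in_itv/= => /(_ vab); lra.
Qed.

(** Each minimality inequality is tested at the other minimizer, and the two are added. *)
Lemma slope_minimizer_mono (f : R -> R) (a b s s' k k' : R) :
  slope_minimizer f a b s k -> slope_minimizer f a b s' k' -> s < s' -> k <= k'.
Proof.
move=> [ka Hk] [ka' Hk'] ss.
have h1 := Hk _ ka'; have h2 := Hk' _ ka.
rewrite leNgt; apply/negP => kk.
have : (s' - s) * (k - k') <= 0 by lra.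
by rewrite leNgt mulr_gt0// subr_gt0.
Qed.

(** One minimizer [k s] is chosen for every slope, but [H] is applied at rational slopes only, so a
    single null set serves all of them. At a point of slope [y], [u] is squeezed between the
    minimizers at rationals on either side of [y], and minimality survives the passage to the limit
    by continuity of [f]. *)
Lemma ae_slope_minimizer (f : R -> R) (a b : R) (u : R * R -> R) : C1 f -> a <= b ->
  {ae (mu \x mu)%E, forall p, 0 <= p.2 -> a <= u p <= b} ->
  (forall s k, slope_minimizer f a b s k ->
    {ae (mu \x mu)%E, forall p : R * R, 0 <= p.2 ->
       (s * p.2 < p.1 -> k <= u p) /\ (p.1 < s * p.2 -> u p <= k)}) ->
  {ae (mu \x mu)%E, forall p, 0 < p.2 -> slope_minimizer f a b (p.1 / p.2) (u p)}.
Proof.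
move=> Cf ab uab H.
have [k Hk] := choice (fun s => slope_minimizer_ex s Cf ab).
have kmono s s' : s < s' -> k s <= k s' by exact: slope_minimizer_mono.
(* [D q] holds at a slope [y] where the monotone map [k] jumps across [q], so it
   has at most one point; away from these slopes [u] is a limit of minimizers. *)
pose D (q : rat) := [set y : R | (forall s, s < y -> k s < ratr q) /\
                             (forall s, y < s -> ratr q < k s)].
have Dline (q : rat) : {ae (mu \x mu)%E, forall p : R * R, 0 < p.2 -> ~ D q (p.1 / p.2)}.
  have [[y Dy]|nD] := pselect (exists y, D q y); last first.
    by exists set0; split => // p; apply => _ Dp; apply: nD; eexists; exact: Dp.
  apply: ae_imp (ae_line y) => p py p0 Dp; apply: py.
  suff <- : p.1 / p.2 = y by rewrite divfK// gt_eqF.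
  have [yp|yp|//] := ltgtP (p.1 / p.2) y.
    pose s := (p.1 / p.2 + y) / 2.
    by have := lt_trans (Dp.2 s (midf_lt yp).1) (Dy.1 s (midf_lt yp).2); rewrite ltxx.
  pose s := (y + p.1 / p.2) / 2.
  by have := lt_trans (Dy.2 s (midf_lt yp).1) (Dp.1 s (midf_lt yp).2); rewrite ltxx.
have Hr := ae_forall_count (fun q : rat => H (ratr q) (k (ratr q)) (Hk _)).
have HD := ae_forall_count Dline.
apply: ae_imp (ae_and uab (ae_and Hr HD)) => p [up [Hp nDp]] p0.
set y := p.1 / p.2; split; first exact/up/ltW.
move=> v vab; rewrite -subr_ge0 leNgt; apply/negP => neg.
(* Otherwise [k] would jump at [y] from at most [u p - d] to at least [u p + d], and a rational in
   between would put [y] in some [D q]. *)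
have near_y d : 0 < d -> exists s : R, `|s - y| < d /\ `|k s - u p| < d.
  move=> d0; apply: contrapT => no.
  have far (q : rat) : `|ratr q - y| < d -> d <= `|k (ratr q) - u p|.
    by move=> qd; rewrite leNgt; apply/negP => kd; apply: no; exists (ratr q).
  have below s : s < y -> k s <= u p - d.
    move=> sy; have : Num.max s (y - d) < y by rewrite gt_max sy ltrBlDr ltrDl.
    move=> /rat_in_itvoo[q]; rewrite in_itv/= gt_max => /andP[/andP[sq dq] qy].
    have qp : ratr q * p.2 < p.1 by rewrite -ltr_pdivlMr.
    have ku := (Hp q (ltW p0)).1 qp.
    have kq := kmono _ _ sq.
    have qd : `|ratr q - y| < d by rewrite ltr0_norm ?subr_lt0//; lra.
    have := far q qd; rewrite distrC ger0_norm ?subr_ge0//; lra.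
  have above s : y < s -> u p + d <= k s.
    move=> sy; have : y < Num.min s (y + d) by rewrite lt_min sy ltrDl.
    move=> /rat_in_itvoo[q]; rewrite in_itv/= lt_min => /andP[qy /andP[sq dq]].
    have qp : p.1 < ratr q * p.2 by rewrite -ltr_pdivrMr.
    have ku := (Hp q (ltW p0)).2 qp.
    have kq := kmono _ _ sq.
    have qd : `|ratr q - y| < d by rewrite gtr0_norm ?subr_gt0//; lra.
    have := far q qd; rewrite ger0_norm ?subr_ge0//; lra.
  have : u p - d < u p + d by lra.
  move=> /rat_in_itvoo[q]; rewrite in_itv/= => /andP[q1 q2].
  apply: (nDp q p0); split => s sy.
    by apply: le_lt_trans q1; exact: below.
  by apply: lt_le_trans q2 _; exact: above.
pose g := - (f v - f (u p) - y * (v - u p)).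
have g0 : 0 < g by rewrite oppr_gt0.
have g4 : 0 < g / 4 by rewrite divr_gt0.
have /cvgrPdist_lt/(_ _ g4)/nbhs_ballP[d1 /= d10 Hd1] := @C1_continuous R f Cf (u p).
(* Replacing [y] and [u p] by [s] and [k s] changes the affine part by at most [d * (b - a + |y|)]
   and [f (u p)] by less than [g / 4], too little to account for the deficit [g]. *)
pose B := b - a + 1 + `|y|.
have B0 : 0 < B by rewrite /B ltr_wpDr// ltr_wpDl// subr_ge0.
pose d := Num.min d1 (g / 4 / B).
have d0 : 0 < d by rewrite lt_min d10 divr_gt0.
have dB : d * B <= g / 4 by rewrite -ler_pdivlMr// ge_min lexx orbT.
have [s [sy ks]] := near_y d d0.
have kb := (Hk s).1; have := (Hk s).2 v vab.
have fk : `|f (u p) - f (k s)| < g / 4.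
  by apply: Hd1; rewrite /ball/= distrC (lt_le_trans ks)// ge_min lexx.
have := ler_norm (f (u p) - f (k s)).
have e1 : `|(s - y) * (v - k s)| <= d * (b - a).
  rewrite normrM ler_pM//; first exact: ltW.
  by rewrite ler_norml; lra.
have e2 : `|y * (u p - k s)| <= d * `|y|.
  by rewrite normrM mulrC ler_wpM2r// distrC ltW.
have := ler_norm (- ((s - y) * (v - k s))); have := ler_norm (- (y * (u p - k s))).
have gE : g = - (f v - f (u p) - y * (v - u p)) by [].
rewrite !normrN; rewrite /B in dB; lra.
Qed.
End profile.

(** * The velocity and its defining inequalities *)

Section velocity.
Context {R : realType}.
Implicit Types (f g : R -> R) (a b c s k v w : R).

Lemma slope_opp (x y z w : R) : (x - y) / (z - w) = (y - x) / (w - z).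
Proof. by rewrite -(opprB y x) -(opprB w z) invrN mulrNN. Qed.

Lemma derive1_gt_near f c s : derivable f c 1 -> s < derive1 f c ->
  exists2 d : R, 0 < d & forall w, `|w - c| < d ->
    (c < w -> s * (w - c) < f w - f c) /\ (w < c -> s * (c - w) < f c - f w).
Proof.
move=> df; rewrite derive1E -subr_gt0 => e0.
have /cvgrPdist_lt/(_ _ e0) : (h^-1 *: ((f \o shift c) (h *: 1) - f c)) @[h --> 0^']
  --> 'D_1 f c by exact: df.
move=> /nbhs_ballP[d /= d0 H]; exists d => // w wd.
have H' : w != c -> s < (w - c)^-1 * (f w - f c).
  move=> wc; have := H (w - c); rewrite /= /ball/= sub0r normrN => /(_ wd).
  rewrite subr_eq0 => /(_ wc); rewrite /GRing.scale/= mulr1 subrK.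
  by have := ler_norm ('D_1 f c - (w - c)^-1 * (f w - f c)); lra.
split=> wc.
  by rewrite -ltr_pdivlMr ?subr_gt0// mulrC; apply: H'; rewrite gt_eqF.
rewrite -ltr_pdivlMr ?subr_gt0//; apply: (lt_le_trans (H' _)); first by rewrite lt_eqF.
rewrite le_eqVlt; apply/orP; left; apply/eqP; field.
by rewrite !subr_eq0 (lt_eqF wc) gt_eqF.
Qed.

Lemma derive1_lt_near f c s : derivable f c 1 -> derive1 f c < s ->
  exists2 d : R, 0 < d & forall w, `|w - c| < d ->
    (c < w -> f w - f c < s * (w - c)) /\ (w < c -> f c - f w < s * (c - w)).
Proof.
move=> df fs; have dN : derivable (- f) c 1 by exact: derivableN.
have : - s < derive1 (- f) c by rewrite derive1E deriveN// -derive1E ltrN2.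
move=> /(derive1_gt_near dN)[d d0 H]; exists d => // w /H[h1 h2].
by split=> [/h1|/h2]; rewrite !fctE/=; lra.
Qed.

(* [V] is the slope at [c] of the convex envelope [g]; at an endpoint the one-sided
   slope need not be [f'(c)], whence the last two fields. *)
Record envelope_slope f g a b c V : Prop := {
  env_le : forall w, a <= w <= b -> g w <= f w;
  env_ge : forall s k, slope_minimizer f a b s k ->
    forall w, a <= w <= b -> f k + s * (w - k) <= g w;
  env_left : forall w, a <= w -> w < c -> g c - g w <= V * (c - w);
  env_right : forall w, c < w -> w <= b -> V * (w - c) <= g w - g c;
  env_left_sup : a < c -> forall s, s < V ->
    exists w, [/\ a <= w, w < c & s * (c - w) < g c - g w];
  env_right_inf : c < b -> forall s, V < s ->
    exists w, [/\ c < w, w <= b & g w - g c < s * (w - c)];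
  env_end : c = b -> derive1 f c <= V;
  env_start : c = a -> V <= derive1 f c }.

(** Testing minimality at [c] would give only [secant <= y]. The margin comes from a fixed minimizer
    [k] at a slope [s] between [V] and [xi]: it lies strictly to the right of [c], so [c < k <= w].
    Testing [w] at [k] gains [(y - s) * (k - c)], to be divided by [w - c <= b - c]. If [c = b],
    then [w = c] and the secant is [derive1 f c]. *)
Lemma secant_upper f g a b c V xi : C1 f -> a <= c <= b ->
  envelope_slope f g a b c V -> V < xi ->
  exists2 kap : R, 0 < kap & forall y w, xi < y -> slope_minimizer f a b y w ->
    secant f w c <= y - kap.
Proof.
move=> Cf /andP[ac cb] E Vxi; have ab : a <= b by exact: le_trans cb.
have cab : a <= c <= b by rewrite ac.
move: (cb); rewrite le_eqVlt => /predU1P[cbE|cltb].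
  exists (xi - V); first by rewrite subr_gt0.
  move=> y w xiy [/andP[aw wb] Hw].
  suff -> : w = c by rewrite /secant eqxx; have := env_end E cbE; lra.
  apply/eqP; rewrite eq_le {1}cbE wb/= leNgt; apply/negP => wc.
  have wab : a <= w <= b by rewrite aw.
  have h1 := env_left E aw wc.
  have := env_ge E (conj wab Hw) cab; have := env_le E wab => h2 h3.
  have : 0 < (y - V) * (c - w) by rewrite mulr_gt0 ?subr_gt0// (lt_trans Vxi).
  lra.
pose s := (V + xi) / 2.
have Vs : V < s by rewrite /s; lra.
have sxi : s < xi by rewrite /s; lra.
have [k Hk] := slope_minimizer_ex s Cf ab.
have kab := Hk.1; have /andP[ak kb] := kab.
have [w0 [cw0 w0b gw0]] := env_right_inf E cltb Vs.
have w0ab : a <= w0 <= b by rewrite w0b (le_trans ac (ltW cw0)).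
have hk := env_ge E Hk w0ab.
have fk : f k - g c < s * (k - c) by lra.
have ck : c < k.
  rewrite ltNge le_eqVlt; apply/negP => /predU1P[kc|kc].
    by move: fk; rewrite kc subrr mulr0 subr_lt0 ltNge (env_le E cab).
  have h1 := env_left E ak kc; have h2 := env_le E kab.
  have : 0 < (s - V) * (c - k) by rewrite mulr_gt0 ?subr_gt0.
  lra.
have bc0 : 0 < b - c by rewrite subr_gt0.
pose kap := (xi - s) * (k - c) / (b - c).
have kap0 : 0 < kap by rewrite divr_gt0// mulr_gt0 ?subr_gt0.
have kapE : kap * (b - c) = (xi - s) * (k - c) by rewrite divfK// gt_eqF.
exists kap => // y w xiy Hw.
have kw := slope_minimizer_mono Hk Hw (lt_trans sxi xiy).
have cw : c < w by exact: lt_le_trans kw.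
have wb : w <= b by have /andP[] := Hw.1.
rewrite /secant gt_eqF// ler_pdivrMr ?subr_gt0//.
have h1 := Hw.2 _ kab; have h2 := env_le E cab.
have h3 : kap * (w - c) <= kap * (b - c) by rewrite ler_wpM2l ?(ltW kap0)// lerD2r.
have : 0 <= (y - xi) * (k - c) by rewrite mulr_ge0// subr_ge0 ltW.
lra.
Qed.

(** Mirror image of [secant_upper]: the fixed minimizer now lies strictly to the left of [c]. *)
Lemma secant_lower f g a b c V xi : C1 f -> a <= c <= b ->
  envelope_slope f g a b c V -> xi < V ->
  exists2 kap : R, 0 < kap & forall y w, y < xi -> slope_minimizer f a b y w ->
    y + kap <= secant f w c.
Proof.
move=> Cf /andP[ac cb] E Vxi; have ab : a <= b by exact: le_trans cb.
have cab : a <= c <= b by rewrite ac.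
move: (ac); rewrite le_eqVlt => /predU1P[caE|altc].
  exists (V - xi); first by rewrite subr_gt0.
  move=> y w xiy [/andP[aw wb] Hw].
  suff -> : w = c by rewrite /secant eqxx; have := env_start E (esym caE); lra.
  apply/eqP; rewrite eq_le -{2}caE aw andbT leNgt; apply/negP => cw.
  have wab : a <= w <= b by rewrite aw.
  have h1 := env_right E cw wb.
  have := env_ge E (conj wab Hw) cab; have := env_le E wab => h2 h3.
  have : 0 < (V - y) * (w - c) by rewrite mulr_gt0 ?subr_gt0// (lt_trans xiy).
  lra.
pose s := (V + xi) / 2.
have Vs : s < V by rewrite /s; lra.
have sxi : xi < s by rewrite /s; lra.
have [k Hk] := slope_minimizer_ex s Cf ab.
have kab := Hk.1; have /andP[ak kb] := kab.
have [w0 [aw0 w0c gw0]] := env_left_sup E altc Vs.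
have w0ab : a <= w0 <= b by rewrite aw0 (le_trans (ltW w0c) cb).
have hk := env_ge E Hk w0ab.
have fk : f k - g c < s * (k - c) by lra.
have kc : k < c.
  rewrite ltNge le_eqVlt; apply/negP => /predU1P[kc|kc].
    by move: fk; rewrite -kc subrr mulr0 subr_lt0 ltNge (env_le E cab).
  have h1 := env_right E kc kb; have h2 := env_le E kab.
  have : 0 < (V - s) * (k - c) by rewrite mulr_gt0 ?subr_gt0.
  lra.
have ca0 : 0 < c - a by rewrite subr_gt0.
pose kap := (s - xi) * (c - k) / (c - a).
have kap0 : 0 < kap by rewrite divr_gt0// mulr_gt0 ?subr_gt0.
have kapE : kap * (c - a) = (s - xi) * (c - k) by rewrite divfK// gt_eqF.
exists kap => // y w xiy Hw.
have kw := slope_minimizer_mono Hw Hk (lt_trans xiy sxi).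
have wc : w < c by exact: le_lt_trans kc.
have aw : a <= w by have /andP[] := Hw.1.
have -> : secant f w c = (f c - f w) / (c - w).
  by rewrite /secant lt_eqF// slope_opp.
rewrite ler_pdivlMr ?subr_gt0//.
have h1 := Hw.2 _ kab; have h2 := env_le E cab.
have h3 : kap * (c - w) <= kap * (c - a) by rewrite ler_wpM2l ?(ltW kap0)//; lra.
have : 0 <= (xi - y) * (c - k) by rewrite mulr_ge0// subr_ge0 ltW.
lra.
Qed.

Definition slopes f c a b := [set (f v - f c) / (v - c) | v in `[a, b]%classic].

Lemma slope_continuous f c a b : C1 f -> (c < a \/ b < c) ->
  {within `[a, b], continuous (fun v => (f v - f c) / (v - c))}.
Proof.
move=> Cf cab; apply: continuous_in_subspaceT => v; rewrite inE/= in_itv/= => vab.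
apply: cvgM; first by apply: cvgB; [exact: C1_continuous|exact: cvg_cst].
apply: cvgV; last by apply: cvgB; [exact: cvg_id|exact: cvg_cst].
by rewrite subr_eq0; case: cab => h; [rewrite gt_eqF|rewrite lt_eqF]; lra.
Qed.

(** Above [V], minimality of [w] is tested at the point [v] realizing the minimum, which gains
    [(y - V) * (v - c)]; the distance from [c] to [[a, b]] keeps this away from 0. Below [V], the
    secant at [w] is at least [V] by definition of the minimum. *)
Lemma min_slope f a b c : C1 f -> a <= b -> c < a ->
  exists V, [/\ is_min (slopes f c a b) V,
    forall xi, V < xi -> exists2 kap : R, 0 < kap & forall y w, xi < y ->
      slope_minimizer f a b y w -> secant f w c <= y - kap &
    forall xi, xi < V -> exists2 kap : R, 0 < kap & forall y w, y < xi ->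
      slope_minimizer f a b y w -> y + kap <= secant f w c].
Proof.
move=> Cf ab ca.
have [v vab Hv] := EVT_min ab (slope_continuous Cf (or_introl ca)).
pose V := (f v - f c) / (v - c).
have vab' : a <= v <= b by move: vab; rewrite in_itv.
have cv : c < v by case/andP: vab' => h _; exact: lt_le_trans h.
have VE : f v - f c = V * (v - c) by rewrite /V divfK// gt_eqF// subr_gt0.
have bc0 : 0 < b - c by rewrite subr_gt0 (lt_le_trans ca).
have ac0 : 0 < a - c by rewrite subr_gt0.
exists V; split.
- split; first by exists v.
  by move=> _ [w wab <-]; exact: Hv.
- move=> xi Vxi; pose kap := (xi - V) * (a - c) / (b - c).
  have kap0 : 0 < kap by rewrite divr_gt0// mulr_gt0// subr_gt0.
  have kapE : kap * (b - c) = (xi - V) * (a - c) by rewrite divfK// gt_eqF.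
  exists kap => // y w xiy [/andP[aw wb] Hw].
  have cw : c < w by exact: lt_le_trans aw.
  rewrite /secant gt_eqF// ler_pdivrMr ?subr_gt0//.
  have h1 := Hw _ vab'.
  have h3 : kap * (w - c) <= kap * (b - c) by rewrite ler_wpM2l ?(ltW kap0)// lerD2r.
  have h4 : (xi - V) * (a - c) <= (y - V) * (v - c).
    by case/andP: vab' => h5 _; apply: ler_pM; lra.
  lra.
- move=> xi Vxi; exists (V - xi); first by rewrite subr_gt0.
  move=> y w yxi [wab _]; have cw : c < w by case/andP: wab => h _; exact: lt_le_trans h.
  rewrite /secant gt_eqF//; have := Hv w; rewrite in_itv/= => /(_ wab).
  by rewrite -/V; lra.
Qed.

(** As in [min_slope], with the two sides exchanged: here the upper bound is immediate and the lower
    one is tested at the extremal point. *)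
Lemma max_slope f a b c : C1 f -> a <= b -> b < c ->
  exists V, [/\ is_max (slopes f c a b) V,
    forall xi, V < xi -> exists2 kap : R, 0 < kap & forall y w, xi < y ->
      slope_minimizer f a b y w -> secant f w c <= y - kap &
    forall xi, xi < V -> exists2 kap : R, 0 < kap & forall y w, y < xi ->
      slope_minimizer f a b y w -> y + kap <= secant f w c].
Proof.
move=> Cf ab bc.
have [v vab Hv] := EVT_max ab (slope_continuous Cf (or_intror bc)).
pose V := (f v - f c) / (v - c).
have vab' : a <= v <= b by move: vab; rewrite in_itv.
have vc : v < c by case/andP: vab' => _ h; exact: le_lt_trans bc.
have VE : f v - f c = V * (v - c) by rewrite /V divfK// lt_eqF// subr_lt0.
have ca0 : 0 < c - a by rewrite subr_gt0 (le_lt_trans ab).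
have cb0 : 0 < c - b by rewrite subr_gt0.
exists V; split.
- split; first by exists v.
  by move=> _ [w wab <-]; exact: Hv.
- move=> xi Vxi; exists (xi - V); first by rewrite subr_gt0.
  move=> y w yxi [wab _]; have wc : w < c by case/andP: wab => _ h; exact: le_lt_trans bc.
  rewrite /secant lt_eqF//; have := Hv w; rewrite in_itv/= => /(_ wab).
  by rewrite -/V; lra.
- move=> xi Vxi; pose kap := (V - xi) * (c - b) / (c - a).
  have kap0 : 0 < kap by rewrite divr_gt0// mulr_gt0// subr_gt0.
  have kapE : kap * (c - a) = (V - xi) * (c - b) by rewrite divfK// gt_eqF.
  exists kap => // y w xiy [/andP[aw wb] Hw].
  have wc : w < c by exact: le_lt_trans bc.
  have -> : secant f w c = (f c - f w) / (c - w).
    by rewrite /secant lt_eqF// slope_opp.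
  rewrite ler_pdivlMr ?subr_gt0//.
  have h1 := Hw _ vab'.
  have h3 : kap * (c - w) <= kap * (c - a) by rewrite ler_wpM2l ?(ltW kap0)//; lra.
  have h4 : (V - xi) * (c - b) <= (V - y) * (c - v).
    by case/andP: vab' => _ h5; apply: ler_pM; lra.
  lra.
Qed.
End velocity.

(** * The convex envelope and its slope at a point *)

Section envelope.
Context {R : realType}.
Implicit Types (f g h : R -> R) (a b c s k v w : R).

Definition convex_minorants f a b := [set h : R -> R |
  convex_function (`[a, b]%classic : set R) h /\ forall w, w \in `[a, b] -> h w <= f w].

Definition convex_envelope f a b v := sup [set h v | h in convex_minorants f a b].

(** Convexity with denominators cleared, which admits coinciding points and is linear in the values
    of [g]. *)
Lemma convex_three_points g a b x y z : convex_function (`[a, b]%classic : set R) g ->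
  a <= x -> x <= y -> y <= z -> z <= b ->
  (z - x) * g y <= (z - y) * g x + (y - x) * g z.
Proof.
move=> /convex_functionP cg ax xy yz zb.
have [xz|xz] := eqVneq x z.
  have yx : y = x by lra.
  by rewrite -xz yx !subrr !mul0r addr0.
have zx0 : 0 < z - x by rewrite subr_gt0 lt_neqAle xz (le_trans xy).
have [t [tE t0 t1]] : exists t, [/\ t * (z - x) = z - y, 0 <= t & t <= 1].
  exists ((z - y) / (z - x)); split; first by rewrite divfK// gt_eqF.
    by rewrite divr_ge0 ?subr_ge0// (le_trans xy).
  by rewrite ler_pdivrMr// mul1r; lra.
have yE : t * x + (1 - t) * z = y by lra.
have /= := cg t x z t0 t1; rewrite !in_itv/= yE => H.
have {}H : g y <= t * g x + (1 - t) * g z by apply: H; lra.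
have := ler_wpM2l (ltW zx0) H.
have -> : (z - x) * (t * g x + (1 - t) * g z) = (t * (z - x)) * g x +
  ((z - x) - t * (z - x)) * g z by ring.
by rewrite tE; congr (_ <= _ + _ * _); lra.
Qed.

Lemma affine_minorant f a b l s k : (forall w, a <= w <= b -> l + s * (w - k) <= f w) ->
  convex_minorants f a b (fun w => l + s * (w - k)).
Proof.
move=> H; split; last by move=> w; rewrite in_itv/=; exact: H.
by apply/convex_functionP => t x y _ _ _ _; rewrite le_eqVlt; apply/orP; left; apply/eqP; ring.
Qed.

(** The supremum is over a nonempty set, which contains the constant minimum of [f], and is bounded
    by [f]; a supremum of convex functions is convex. *)
Lemma convex_envelopeP f a b : C1 f -> a <= b ->
  convex_minorants f a b (convex_envelope f a b) /\
  forall h, convex_minorants f a b h -> forall w, a <= w <= b -> h w <= convex_envelope f a b w.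
Proof.
move=> Cf ab.
have [z _ Hz] := EVT_min ab (continuous_subspaceT (C1_continuous Cf)).
have m0 : convex_minorants f a b (fun w => f z + 0 * (w - a)).
  by apply: affine_minorant => w wab; rewrite mul0r addr0; apply: Hz; rewrite in_itv.
have hS v : a <= v <= b -> has_sup [set h v | h in convex_minorants f a b].
  move=> vab; split; first by exists (f z + 0 * (v - a)); exists (fun w => f z + 0 * (w - a)).
  by exists (f v) => _ [h [_ hf] <-]; apply: hf; rewrite in_itv.
have ge h : convex_minorants f a b h -> forall w, a <= w <= b -> h w <= convex_envelope f a b w.
  by move=> hm w wab; apply: (ub_le_sup (hS _ wab).2); exists h.
split => //; split.
  apply/convex_functionP => t x y t0 t1; rewrite /= !in_itv/= => xab yab.
  have txy : a <= t * x + (1 - t) * y <= b.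
    have t1' : 0 <= 1 - t by lra.
    case/andP: xab => x1 x2; case/andP: yab => y1 y2.
    have := ler_wpM2l t0 x1; have := ler_wpM2l t0 x2.
    have := ler_wpM2l t1' y1; have := ler_wpM2l t1' y2; lra.
  apply: ge_sup; first exact: (hS _ txy).1.
  move=> _ [h hm <-]; have [/convex_functionP ch _] := hm.
  apply: (le_trans (ch t x y t0 t1 _ _)); rewrite /= ?in_itv//.
  by apply: lerD; apply: ler_wpM2l; rewrite ?subr_ge0//; exact: ge.
move=> w; rewrite in_itv/= => wab; apply: ge_sup; first exact: (hS _ wab).1.
by move=> _ [h [_ hf] <-]; apply: hf; rewrite in_itv.
Qed.

Lemma convex_envelope_is_envelope f a b : C1 f -> a <= b ->
  is_convex_envelope f a b (convex_envelope f a b).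
Proof.
move=> Cf ab v; rewrite in_itv/= => vab; have [m ge] := convex_envelopeP Cf ab.
split; first by exists (convex_envelope f a b).
by move=> _ [h hm <-]; exact: ge.
Qed.

(** [V] is the left derivative of the envelope, as a supremum of slopes, or its right derivative, as
    an infimum, when [c = a]. The substance is that at an interior point the right slopes come down
    to the same [V]. *)
Lemma envelope_slope_ex f a b c : C1 f -> a < b -> a <= c <= b ->
  exists V, envelope_slope f (convex_envelope f a b) a b c V.
Proof.
move=> Cf altb cab; have ab := ltW altb; have /andP[ac cb] := cab.
have [[cg gf] ge] := convex_envelopeP Cf ab.
set g := convex_envelope f a b in cg gf ge *.
have env_le_ w : a <= w <= b -> g w <= f w by move=> wab; apply: gf; rewrite in_itv.
have env_ge_ s k : slope_minimizer f a b s k -> forall w, a <= w <= b -> f k + s * (w - k) <= g w.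
  move=> [kab Hk] w wab; apply: (ge (fun w => f k + s * (w - k))) => //.
  by apply: affine_minorant => v /Hk; lra.
have [L L0 HL] := C1_lipschitz (`|a| + `|b|) Cf.
have inr w : a <= w <= b -> - (`|a| + `|b|) <= w <= `|a| + `|b|.
  move=> /andP[h1 h2]; have := ler_norm b; have := ler_norm (- a); rewrite normrN.
  by have := normr_ge0 a; have := normr_ge0 b; lra.
have aab : a <= a <= b by rewrite lexx.
have bab : a <= b <= b by rewrite lexx ab.
(* The lines of slopes [- L] at [a] and [L] at [b] stay below the graph. Hence the envelope meets
   [f] at both endpoints, and its slopes there are bounded. *)
have mina : slope_minimizer f a b (- L) a.
  split => // v vab; have := HL v a (inr _ vab) (inr _ aab).
  have -> : `|v - a| = v - a by rewrite ger0_norm// subr_ge0; case/andP: vab.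
  by have := ler_norm (- (f v - f a)); rewrite normrN; lra.
have minb : slope_minimizer f a b L b.
  split => // v vab; have := HL v b (inr _ vab) (inr _ bab).
  have -> : `|v - b| = b - v by rewrite distrC ger0_norm// subr_ge0; case/andP: vab.
  by have := ler_norm (- (f v - f b)); rewrite normrN; lra.
have ga : g a = f a.
  apply/eqP; rewrite eq_le env_le_//=.
  by have := env_ge_ _ _ mina a aab; rewrite subrr mulr0 addr0.
have gb : g b = f b.
  apply/eqP; rewrite eq_le env_le_//=.
  by have := env_ge_ _ _ minb b bab; rewrite subrr mulr0 addr0.
have [df _] := Cf.
move: (ac); rewrite le_eqVlt => /predU1P[acE|altc].
  subst c.
  pose Q := [set (g w - g a) / (w - a) | w in `]a, b]%classic].
  have hQ : has_inf Q.
    split; first by exists ((g b - g a) / (b - a)); exists b; rewrite //= in_itv/= altb lexx.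
    exists (- L) => r [w]; rewrite /= in_itv/= => /andP[aw wb] <-.
    rewrite ler_pdivlMr ?subr_gt0//; have := env_ge_ _ _ mina w; rewrite ga.
    by rewrite (ltW aw) wb => /(_ isT); lra.
  have Qw w : a < w -> w <= b -> inf Q * (w - a) <= g w - g a.
    move=> aw wb; rewrite -ler_pdivlMr ?subr_gt0//; apply: (ge_inf hQ.2).
    by exists w; rewrite //= in_itv/= aw wb.
  exists (inf Q); split => //.
  - by move=> w aw wa; lra.
  - by rewrite ltxx.
  - move=> _ s; rewrite -subr_gt0 => sV; have [r [w + <-]] := inf_adherent sV hQ.
    rewrite /= in_itv/= subrKC => /andP[aw wb]; rewrite ltr_pdivrMr ?subr_gt0// => gw.
    by exists w.
  - by move=> E; rewrite E ltxx in altb.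
  - move=> _; rewrite leNgt; apply/negP => fV.
    have [d d0 Hd] := derive1_lt_near (df a) fV.
    pose w := Num.min (a + d / 2) b.
    have aw : a < w by rewrite lt_min altb andbT ltrDl divr_gt0.
    have wb : w <= b by rewrite ge_min lexx orbT.
    have wd : w <= a + d / 2 by rewrite ge_min lexx.
    have [|/(_ aw) h _] := Hd w; first by rewrite gtr0_norm ?subr_gt0//; lra.
    have := Qw w aw wb; have := env_le_ w; rewrite (ltW aw) wb => /(_ isT); rewrite ga; lra.
pose Q := [set (g c - g w) / (c - w) | w in `[a, c[%classic].
have hQ : has_sup Q.
  split; first by exists ((g c - g a) / (c - a)); exists a; rewrite //= in_itv/= altc lexx.
  move: (cb); rewrite le_eqVlt => /predU1P[cbE|cltb].
    exists L => r [w]; rewrite /= in_itv/= => /andP[aw wc] <-.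
    rewrite ler_pdivrMr ?subr_gt0//; have := env_ge_ _ _ minb w; rewrite cbE gb.
    by rewrite aw -cbE (ltW wc) => /(_ isT); lra.
  exists ((g b - g c) / (b - c)) => r [w]; rewrite /= in_itv/= => /andP[aw wc] <-.
  rewrite ler_pdivrMr ?subr_gt0// mulrAC ler_pdivlMr ?subr_gt0//.
  have := convex_three_points cg aw (ltW wc) cb (lexx b); lra.
have Qw w : a <= w -> w < c -> g c - g w <= sup Q * (c - w).
  move=> aw wc; rewrite -ler_pdivrMr ?subr_gt0//; apply: (ub_le_sup hQ.2).
  by exists w; rewrite //= in_itv/= aw wc.
have Qs s : s < sup Q -> exists w, [/\ a <= w, w < c & s * (c - w) < g c - g w].
  rewrite -subr_gt0 => sV; have [r [w + <-]] := sup_adherent sV hQ.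
  rewrite /= in_itv/= subKr => /andP[aw wc]; rewrite ltr_pdivlMr ?subr_gt0// => gw.
  by exists w.
(* Where [f] and [g] touch, [g <= f] makes the left slopes of [f] at most those of [g]. This serves
   at [c = b] as well as at interior contact points. *)
have dleft : f c <= g c -> derive1 f c <= sup Q.
  move=> fg; rewrite leNgt; apply/negP => fV.
  have [d d0 Hd] := derive1_gt_near (df c) fV.
  pose w := Num.max (c - d / 2) a.
  have wc : w < c by rewrite gt_max altc andbT ltrBlDr ltrDl divr_gt0.
  have aw : a <= w by rewrite le_max lexx orbT.
  have wd : c - d / 2 <= w by rewrite le_max lexx.
  have [|_ /(_ wc) h] := Hd w; first by rewrite ltr0_norm ?subr_lt0//; lra.
  have := Qw w aw wc; have := env_le_ w; rewrite aw (le_trans (ltW wc) cb) => /(_ isT); lra.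
have Qr w : c < w -> w <= b -> sup Q * (w - c) <= g w - g c.
  move=> cw wb; rewrite -ler_pdivlMr ?subr_gt0//; apply: ge_sup hQ.1 _.
  move=> r [v]; rewrite /= in_itv/= => /andP[av vc] <-.
  rewrite ler_pdivrMr ?subr_gt0// mulrAC ler_pdivlMr ?subr_gt0//.
  have := convex_three_points cg av (ltW vc) (ltW cw) wb; lra.
exists (sup Q); split => //; last 2 first.
- by move=> cbE; apply: dleft; rewrite cbE gb.
- by move=> caE; rewrite caE ltxx in altc.
move=> cltb s Vs; apply: contrapT => no.
have right w : c < w -> w <= b -> s * (w - c) <= g w - g c.
  by move=> cw wb; rewrite leNgt; apply/negP => h; apply: no; exists w.
(* A line through [(c, g c)] of slope strictly between the one-sided slopes of [g]
   would lie strictly below [f], were [g c < f c]; so [f] and [g] touch at [c], and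
   the differentiability of [f] forbids a corner of [g]. *)
have fg : f c <= g c.
  pose m := (sup Q + s) / 2.
  have Vm : sup Q < m by rewrite /m; lra.
  have ms : m < s by rewrite /m; lra.
  have [k Hk] := slope_minimizer_ex m Cf ab; have kab := Hk.1; have /andP[ak kb] := kab.
  have h1 := env_ge_ _ _ Hk c cab; have h2 := env_le_ k kab.
  have [kc|ck|kcE] := ltgtP k c.
  - have h3 := Qw k ak kc.
    have : 0 < (m - sup Q) * (c - k) by rewrite mulr_gt0// subr_gt0.
    lra.
  - have h3 := right k ck kb.
    have : 0 < (s - m) * (k - c) by rewrite mulr_gt0// subr_gt0.
    lra.
  - by move: h1; rewrite kcE subrr mulr0 addr0.
have fs : derive1 f c < s by apply: le_lt_trans Vs; exact: dleft.
have [d d0 Hd] := derive1_lt_near (df c) fs.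
pose w := Num.min (c + d / 2) b.
have cw : c < w by rewrite lt_min cltb andbT ltrDl divr_gt0.
have wb : w <= b by rewrite ge_min lexx orbT.
have wd : w <= c + d / 2 by rewrite ge_min lexx.
have [|/(_ cw) h _] := Hd w; first by rewrite gtr0_norm ?subr_gt0//; lra.
have := right w cw wb; have := env_le_ w; rewrite (le_trans ac (ltW cw)) wb => /(_ isT); lra.
Qed.

(** Slopes of a convex function from [c] are monotone, so one point [w0] whose slope is within [e]
    of [V] controls every [w] between [c] and [w0]. *)
Lemma envelope_slope_derive f a b c V : C1 f -> a < b -> a <= c <= b ->
  envelope_slope f (convex_envelope f a b) a b c V ->
  is_envelope_derive f (convex_envelope f a b) a b c V.
Proof.
move=> Cf altb /andP[ac cb] E; have ab := ltW altb.
have [[cg gf] _] := convex_envelopeP Cf ab.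
set g := convex_envelope f a b in cg gf E *.
rewrite /is_envelope_derive (lt_eqF altb).
apply/cvgrPdist_le => e e0.
have Vr : exists2 d : R, 0 < d & forall w, c < w -> w <= b -> w < c + d ->
    g w - g c <= (V + e) * (w - c).
  have [cltb|bc] := ltP c b; last by exists 1 => // w cw wb; lra.
  have Vs : V < V + e by rewrite ltrDl.
  have [w0 [cw0 w0b gw0]] := env_right_inf E cltb Vs.
  exists (w0 - c); first by rewrite subr_gt0.
  move=> w cw wb wd; have ww0 : w <= w0 by lra.
  have h := convex_three_points cg ac (ltW cw) ww0 w0b.
  have w0c : 0 < w0 - c by rewrite subr_gt0.
  have hh : (w - c) * (g w0 - g c) <= (w - c) * ((V + e) * (w0 - c)).
    by rewrite ler_wpM2l ?subr_ge0// ltW.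
  rewrite -(ler_pM2l w0c); lra.
have Vl : exists2 d : R, 0 < d & forall w, a <= w -> w < c -> c - d < w ->
    (V - e) * (c - w) <= g c - g w.
  have [altc|ca] := ltP a c; last by exists 1 => // w cw wb; lra.
  have Vs : V - e < V by rewrite ltrBlDr ltrDl.
  have [w0 [aw0 w0c gw0]] := env_left_sup E altc Vs.
  exists (c - w0); first by rewrite subr_gt0.
  move=> w aw wc wd; have ww0 : w0 <= w by lra.
  have h := convex_three_points cg aw0 ww0 (ltW wc) cb.
  have cw0 : 0 < c - w0 by rewrite subr_gt0.
  have hh : (c - w) * ((V - e) * (c - w0)) <= (c - w) * (g c - g w0).
    by rewrite ler_wpM2l ?subr_ge0// ltW.
  rewrite -(ler_pM2l cw0); lra.
have [dr dr0 Hr] := Vr; have [dl dl0 Hl] := Vl.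
rewrite near_withinE; apply/nbhs_ballP; exists (Num.min dr dl) => /=.
  by rewrite lt_min dr0.
move=> w; rewrite /ball/= lt_min => /andP[wr wl] wc.
rewrite in_itv/= => /andP[aw wb].
have [wltc|cw|wE] := ltgtP w c; last by rewrite wE eqxx in wc.
  have cw0 : 0 < c - w by rewrite subr_gt0.
  rewrite gtr0_norm// in wl.
  have h1 := env_left E aw wltc; have h2 : (V - e) * (c - w) <= g c - g w by apply: Hl => //; lra.
  rewrite -(opprB c w) -(opprB (g c) (g w)) invrN mulrNN.
  have i1 : (g c - g w) / (c - w) <= V by rewrite ler_pdivrMr.
  have i2 : V - e <= (g c - g w) / (c - w) by rewrite ler_pdivlMr.
  by rewrite ler_norml; lra.
have wc0 : 0 < w - c by rewrite subr_gt0.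
rewrite distrC gtr0_norm// in wr.
have h1 := env_right E cw wb; have h2 : g w - g c <= (V + e) * (w - c) by apply: Hr => //; lra.
have i1 : V <= (g w - g c) / (w - c) by rewrite ler_pdivlMr.
have i2 : (g w - g c) / (w - c) <= V + e by rewrite ler_pdivrMr.
by rewrite ler_norml; lra.
Qed.
End envelope.

(** * Filippov solutions of a self-similar field *)

Section envelopes_of_field.
Context {R : realType}.
Local Notation mu := (@lebesgue_measure R).
Implicit Types (a : R * R -> R) (x t d M : R).

Lemma ae_mrestrP (I : set (measurableTypeR R)) (mI : measurable I) (P : R -> Prop) :
  {ae mrestr mu mI, forall y, P y} <-> {ae mu, forall y, I y -> P y}.
Proof.
split=> [[N [mN N0 sN]]|[N [mN N0 sN]]].
  exists (N `&` I); split => //; first exact: measurableI.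
  move=> y /not_implyP[Iy nP]; split => //; exact: sN.
exists (N `|` ~` I); split.
- by apply: measurableU => //; exact: measurableC.
- rewrite /mrestr setIUl setICl setU0.
  by apply: (@subset_measure0 _ _ _ mu _ N) => //; exact: measurableI.
- by move=> y nP; have [Iy|] := pselect (I y); [left; apply: sN => /= /(_ Iy)|right].
Qed.

Lemma ess_sup_ball_leP a x t d (M : \bar R) : (ess_sup_ball a x t d <= M)%E <->
  {ae mu, forall y, x - d < y < x + d -> ((a (y, t))%:E <= M)%E}.
Proof.
rewrite /ess_sup_ball; split.
  by move=> /ess_supP/ae_mrestrP; apply: ae_imp => y H xy; apply: H; rewrite /= in_itv.
by move=> H; apply/ess_supP/ae_mrestrP; apply: ae_imp H => y H; rewrite /= in_itv.
Qed.

Lemma ess_inf_ball_geP a x t d (M : \bar R) : (M <= ess_inf_ball a x t d)%E <->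
  {ae mu, forall y, x - d < y < x + d -> (M <= (a (y, t))%:E)%E}.
Proof.
rewrite /ess_inf_ball; split.
  by move=> /ess_infP/ae_mrestrP; apply: ae_imp => y H xy; apply: H; rewrite /= in_itv.
by move=> H; apply/ess_infP/ae_mrestrP; apply: ae_imp H => y H; rewrite /= in_itv.
Qed.

(** The essential supremum decreases with the radius, so its limit at 0 is an infimum over all
    radii. *)
Lemma upper_envE a x t : upper_env a x t =
  ereal_inf [set ess_sup_ball a x t d | d in `]0, +oo[%classic].
Proof.
apply/cvg_lim => //; apply: (@nondecreasing_at_right_cvge _ _ _ +oo%O) => // d d' _ _ dd.
apply/ess_sup_ball_leP.
have /ess_sup_ball_leP := lexx (ess_sup_ball a x t d').
by apply: ae_imp => y H xy; apply: H; lra.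
Qed.

Lemma lower_envE a x t : lower_env a x t =
  ereal_sup [set ess_inf_ball a x t d | d in `]0, +oo[%classic].
Proof.
apply/cvg_lim => //; apply: (@nonincreasing_at_right_cvge _ _ _ +oo%O) => // d d' _ _ dd.
apply/ess_inf_ball_geP.
have /ess_inf_ball_geP := lexx (ess_inf_ball a x t d').
by apply: ae_imp => y H xy; apply: H; lra.
Qed.

Lemma upper_env_le a x t d M : 0 < d ->
  {ae mu, forall y, x - d < y < x + d -> a (y, t) <= M} -> (upper_env a x t <= M%:E)%E.
Proof.
move=> d0 H; rewrite upper_envE; apply: (@le_trans _ _ (ess_sup_ball a x t d)).
  by apply: ereal_inf_lbound; exists d; rewrite //= in_itv/= d0.
by apply/ess_sup_ball_leP; apply: ae_imp H => y; rewrite lee_fin.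
Qed.

Lemma lower_env_ge a x t d M : 0 < d ->
  {ae mu, forall y, x - d < y < x + d -> M <= a (y, t)} -> (M%:E <= lower_env a x t)%E.
Proof.
move=> d0 H; rewrite lower_envE; apply: (@le_trans _ _ (ess_inf_ball a x t d)).
  by apply/ess_inf_ball_geP; apply: ae_imp H => y; rewrite lee_fin.
by apply: ereal_sup_ubound; exists d; rewrite //= in_itv/= d0.
Qed.

Lemma ae_itv_ex (P : R -> Prop) (x y : R) : x < y -> {ae mu, forall z, P z} ->
  exists2 z, x < z < y & P z.
Proof.
move=> xy [N [mN N0 sN]]; apply: contrapT => no.
have : (mu `]x, y[%classic <= mu N)%E.
  apply: le_measure; rewrite ?inE//.
  move=> z; rewrite /= in_itv/= => xzy; apply: sN => Pz; apply: no; by exists z.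
rewrite [X in (_ <= X)%E]N0 lebesgue_measure_itv/= lte_fin xy -EFinB lee_fin.
by rewrite leNgt subr_gt0 xy.
Qed.

(** A one-sided neighbourhood has positive measure, hence suffices. The left side is chosen because,
    to the left of the ray, the field exceeds [y / t]. *)
Lemma upper_env_ge a x t M : (forall e, 0 < e -> exists2 d : R, 0 < d &
    {ae mu, forall y, x - d < y < x -> M - e <= a (y, t)}) ->
  (M%:E <= upper_env a x t)%E.
Proof.
move=> H; rewrite upper_envE; apply/ereal_infP => r [d]; rewrite /= in_itv/= andbT => d0 <-.
apply/lee_subgt0Pr => e e0; rewrite leNgt; apply/negP => ltM.
have [d' d'0 H'] := H e e0.
have /ess_sup_ball_leP H2 := lexx (ess_sup_ball a x t d).
have xx : Num.max (x - d) (x - d') < x by rewrite gt_max !ltrBlDr !ltrDl d0.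
have [z] := ae_itv_ex xx (ae_and H' H2).
rewrite gt_max => /andP[/andP[z1 z2] z3] [h1 h2].
have : ((M - e)%:E <= (a (z, t))%:E)%E by rewrite lee_fin; apply: h1; rewrite z2.
have h3 : x - d < z < x + d by lra.
move=> /le_lt_trans/(_ (le_lt_trans (h2 h3) ltM)).
by rewrite EFinB ltxx.
Qed.

Lemma lower_env_le a x t M : (forall e, 0 < e -> exists2 d : R, 0 < d &
    {ae mu, forall y, x < y < x + d -> a (y, t) <= M + e}) ->
  (lower_env a x t <= M%:E)%E.
Proof.
move=> H; rewrite lower_envE; apply: ge_ereal_sup => r [d]; rewrite /= in_itv/= andbT => d0 <-.
apply/lee_addgt0Pr => e e0; rewrite leNgt; apply/negP => ltM.
have [d' d'0 H'] := H e e0.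
have /ess_inf_ball_geP H2 := lexx (ess_inf_ball a x t d).
have xx : x < Num.min (x + d) (x + d') by rewrite lt_min !ltrDl d0.
have [z] := ae_itv_ex xx (ae_and H' H2).
rewrite lt_min => /andP[z1 /andP[z2 z3]] [h1 h2].
have : ((a (z, t))%:E <= (M + e)%:E)%E by rewrite lee_fin; apply: h1; rewrite z1.
move=> /le_lt_trans /(_ ltM).
by rewrite ltNge h2//; lra.
Qed.

End envelopes_of_field.

(** * Existence and uniqueness of the ray solution *)

Section filippov_ray.
Context {R : realType}.
Local Notation mu := (@lebesgue_measure R).
Variables (a : R * R -> R) (V K : R).
Hypothesis bounded : {ae mu, forall t : R, 0 < t -> {ae mu, forall y, `|a (y, t)| <= K}}.
Hypothesis slow : forall xi, V < xi -> exists2 kap : R, 0 < kap &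
  {ae mu, forall t : R, 0 < t -> {ae mu, forall y, xi < y / t -> a (y, t) <= y / t - kap}}.
Hypothesis fast : forall xi, xi < V -> exists2 kap : R, 0 < kap &
  {ae mu, forall t : R, 0 < t -> {ae mu, forall y, y / t < xi -> y / t + kap <= a (y, t)}}.

Lemma abs_continuous_linear (s T : R) : abs_continuous s T (fun t => V * t).
Proof.
move=> e e0; have V1 : 0 < `|V| + 1 by rewrite ltr_wpDl.
exists (e / (`|V| + 1)); first by rewrite divr_gt0.
move=> n sq rq H _; rewrite ltr_pdivlMr// => Hd; apply: le_lt_trans Hd.
rewrite mulr_suml; apply: ler_sum => i _.
have [_ [sr _]] := H i.
rewrite -mulrBr normrM (ger0_norm (_ : 0 <= rq i - sq i)) ?subr_ge0//.
by rewrite mulrC ler_wpM2l ?subr_ge0// lerDl.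
Qed.

Lemma is_derive_linear (t : R) : is_derive t 1 (fun t => V * t) V.
Proof.
have := is_deriveM (is_derive_cst V t 1) (is_derive_id t 1).
by rewrite /GRing.scale/= mulr1 mulr0 addr0.
Qed.

(** Along [xi = V + 1/(n+1)] and [xi = V - 1/(n+1)] the bounds extend up to the ray: the field is at
    most [y / t] on its right and at least [y / t] on its left. As [y / t] tends to [V], the right
    side bounds the lower envelope and the left side the upper one. *)
Lemma filippov_ray : filippov_solution a 0 0 (fun t => V * t).
Proof.
split; [by move=> T; exact: abs_continuous_linear|by rewrite mulr0|].
have slow_n (n : nat) : {ae mu, forall t : R, 0 < t -> {ae mu, forall y,
    V + n.+1%:R^-1 < y / t -> a (y, t) <= y / t}}.
  have [|kap kap0 H] := slow (xi := V + n.+1%:R^-1); first by rewrite ltrDl invr_gt0.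
  apply: ae_imp H => t H t0; apply: ae_imp (H t0) => y Hy /Hy; lra.
have fast_n (n : nat) : {ae mu, forall t : R, 0 < t -> {ae mu, forall y,
    y / t < V - n.+1%:R^-1 -> y / t <= a (y, t)}}.
  have [|kap kap0 H] := fast (xi := V - n.+1%:R^-1).
    by rewrite ltrBlDr ltrDl invr_gt0.
  apply: ae_imp H => t H t0; apply: ae_imp (H t0) => y Hy /Hy; lra.
have := ae_and (ae_foralln slow_n) (ae_foralln fast_n).
apply: ae_imp => t [Hs Hf] t0; split; first exact: (ex_derive (is_derive := is_derive_linear t)).
have Hs' : {ae mu, forall y, V < y / t -> a (y, t) <= y / t}.
  have := ae_foralln (fun n => Hs n t0); apply: ae_imp => y Hy Vy.
  have y0 : 0 < y / t - V by rewrite subr_gt0.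
  apply: (Hy (Num.truncn (y / t - V)^-1)); rewrite addrC -ltrBrDr.
  by rewrite invf_plt ?posrE// truncnS_gt.
have Hf' : {ae mu, forall y, y / t < V -> y / t <= a (y, t)}.
  have := ae_foralln (fun n => Hf n t0); apply: ae_imp => y Hy Vy.
  have y0 : 0 < V - y / t by rewrite subr_gt0.
  apply: (Hy (Num.truncn (V - y / t)^-1)); rewrite ltrBrDr addrC -ltrBrDr.
  by rewrite invf_plt ?posrE// truncnS_gt.
have [_ dV] := is_derive_linear t; rewrite derive1E dV; apply/andP; split.
  apply: lower_env_le => e e0; exists (e * t); first by rewrite mulr_gt0.
  apply: ae_imp Hs' => y Hy /andP[y1 y2].
  apply: (le_trans (Hy _)); first by rewrite ltr_pdivlMr.
  by rewrite ler_pdivrMr// mulrDl ltW.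
apply: upper_env_ge => e e0; exists (e * t); first by rewrite mulr_gt0.
apply: ae_imp Hf' => y Hy /andP[y1 y2].
apply: le_trans (Hy _); last by rewrite ltr_pdivrMr.
by rewrite ler_pdivlMr// mulrBl ltW.
Qed.

Lemma upper_env_bound : {ae mu, forall t : R, 0 < t -> forall x, (upper_env a x t <= K%:E)%E}.
Proof.
apply: ae_imp bounded => t H t0 x; apply: (@upper_env_le _ _ _ _ 1) => //.
by apply: ae_imp (H t0) => y; rewrite ler_norml => /andP[_ ?] _.
Qed.

Lemma lower_env_bound : {ae mu, forall t : R, 0 < t -> forall x, ((- K)%:E <= lower_env a x t)%E}.
Proof.
apply: ae_imp bounded => t H t0 x; apply: (@lower_env_ge _ _ _ _ 1) => //.
by apply: ae_imp (H t0) => y; rewrite ler_norml => /andP[? _] _.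
Qed.

(** The field is controlled for almost every [y], but a solution follows one particular curve, so
    the bound is needed at every [x]. The envelope provides it, since a small ball around [x] stays
    beyond the line of slope [xi]. *)
Lemma upper_env_slow xi : V < xi -> exists2 kap : R, 0 < kap &
  {ae mu, forall t : R, 0 < t -> forall x, xi * t < x -> (upper_env a x t <= (x / t - kap)%:E)%E}.
Proof.
move=> /slow[kap kap0 H]; exists kap => //.
apply: ae_imp H => t H t0 x xt.
apply/lee_addgt0Pr => e e0; rewrite -EFinD.
pose d := Num.min (x - xi * t) (e * t).
have d0 : 0 < d by rewrite lt_min subr_gt0 xt mulr_gt0.
apply: (@upper_env_le _ _ _ _ d) => //; apply: ae_imp (H t0) => y Hy /andP[y1 y2].
have d1 : d <= x - xi * t by rewrite ge_min lexx.
have d2 : d <= e * t by rewrite ge_min lexx orbT.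
apply: (le_trans (Hy _)); first by rewrite ltr_pdivlMr//; lra.
have : y / t <= x / t + e by rewrite ler_pdivrMr// mulrDl divfK ?gt_eqF//; lra.
lra.
Qed.

Lemma lower_env_fast xi : xi < V -> exists2 kap : R, 0 < kap &
  {ae mu, forall t : R, 0 < t -> forall x, x < xi * t -> ((x / t + kap)%:E <= lower_env a x t)%E}.
Proof.
move=> /fast[kap kap0 H]; exists kap => //.
apply: ae_imp H => t H t0 x xt.
apply/lee_subgt0Pr => e e0; rewrite -EFinB.
pose d := Num.min (xi * t - x) (e * t).
have d0 : 0 < d by rewrite lt_min subr_gt0 xt mulr_gt0.
apply: (@lower_env_ge _ _ _ _ d) => //; apply: ae_imp (H t0) => y Hy /andP[y1 y2].
have d1 : d <= xi * t - x by rewrite ge_min lexx.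
have d2 : d <= e * t by rewrite ge_min lexx orbT.
apply: le_trans (Hy _); last by rewrite ltr_pdivrMr//; lra.
have : x / t - e <= y / t by rewrite ler_pdivlMr// mulrBl divfK ?gt_eqF//; lra.
lra.
Qed.

(** The barrier is applied to [x] with [V] and to [- x] with [- V]. *)
Lemma filippov_ray_unique (x : R -> R) : filippov_solution a 0 0 x ->
  forall t, 0 <= t -> x t = V * t.
Proof.
move=> [acx x0 Hx] t t0; apply/eqP; rewrite eq_le; apply/andP; split.
  apply: (@filippov_barrier _ x V K) => //.
    apply: ae_imp (ae_and Hx upper_env_bound) => s [Hs us] s0.
    have [ds /andP[_ h2]] := Hs s0; split => //.
    by rewrite -lee_fin; apply: le_trans h2 (us s0 _).
  move=> xi /upper_env_slow[kap kap0 H]; exists kap => //.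
  apply: ae_imp (ae_and Hx H) => s [Hs us] s0 xs.
  have [ds /andP[_ h2]] := Hs s0; split => //.
  by rewrite -lee_fin; apply: le_trans h2 (us s0 _ xs).
rewrite -lerN2 -mulNr.
have dN s : derivable x s 1 -> derivable (- x) s 1 /\ derive1 (- x) s = - derive1 x s.
  by move=> ds; split; [exact: derivableN|rewrite !derive1E deriveN].
apply: (@filippov_barrier _ (- x) (- V) K) => //.
- move=> T e /(acx T)[d d0 H]; exists d => // n sq rq h1 h2 h3.
  under eq_bigr do rewrite !fctE/= -opprD normrN.
  exact: H.
- by rewrite fctE x0 oppr0.
- apply: ae_imp (ae_and Hx lower_env_bound) => s [Hs us] s0.
  have [ds /andP[h1 _]] := Hs s0; have [dn dE] := dN _ ds; split => //.
  by rewrite dE lerNl -lee_fin; apply: le_trans (us s0 _) h1.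
- move=> xi; rewrite ltrNl => /lower_env_fast[kap kap0 H]; exists kap => //.
  apply: ae_imp (ae_and Hx H) => s [Hs us] s0 xs.
  have [ds /andP[h1 _]] := Hs s0; have [dn dE] := dN _ ds; split => //.
  rewrite dE fctE mulNr -opprD lerN2 -lee_fin; apply: le_trans (us s0 _ _) h1.
  by rewrite mulNr ltrNr.
Qed.
End filippov_ray.

(** * The two orderings of the Riemann data *)

Section assembly.
Context {R : realType}.
Local Notation mu := (@lebesgue_measure R).
Implicit Types (f : R -> R) (u : R * R -> R).

Definition secant_separated f (a b c V : R) :=
  (forall xi, V < xi -> exists2 kap : R, 0 < kap & forall y w, xi < y ->
      slope_minimizer f a b y w -> secant f w c <= y - kap) /\
  (forall xi, xi < V -> exists2 kap : R, 0 < kap & forall y w, y < xi ->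
      slope_minimizer f a b y w -> y + kap <= secant f w c).

(** The degenerate interval is kept apart because, when [uL = uR], one [V] has to satisfy both the
    increasing and the decreasing branches of [is_velocity]. *)
Lemma velocity_ex f (a b c : R) : C1 f -> a <= b -> exists V,
  [/\ c < a -> is_min (slopes f c a b) V,
      b < c -> is_max (slopes f c a b) V,
      a < b -> a <= c <= b -> exists2 g, is_convex_envelope f a b g &
        is_envelope_derive f g a b c V,
      a = b -> c = a -> V = derive1 f c &
      secant_separated f a b c V].
Proof.
move=> Cf ab.
have lt_or_le (x y : R) : x < y \/ y <= x by case: ltP; [left|right].
have [ca|ac] := lt_or_le c a.
  have [V [h1 h2 h3]] := min_slope Cf ab ca; exists V; split => //.
  - by move=> bc; lra.
  - by move=> _ cab; lra.
  - by move=> _ E; rewrite E ltxx in ca.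
have [bc|cb] := lt_or_le b c.
  have [V [h1 h2 h3]] := max_slope Cf ab bc; exists V; split => //.
  - by move=> ca; lra.
  - by move=> _ cab; lra.
  - by move=> E1 E2; rewrite E2 E1 ltxx in bc.
have cab : a <= c <= b by rewrite ac.
have [abE|altb] := eqVneq a b.
  subst b; have cE : c = a by lra.
  subst c; exists (derive1 f a); split => //; try by rewrite ltxx.
  have wE y w : slope_minimizer f a a y w -> w = a by move=> [/andP[h1 h2] _]; lra.
  split => xi xiV.
    exists (xi - derive1 f a); first by rewrite subr_gt0.
    by move=> y w xiy /wE ->; rewrite /secant eqxx; lra.
  exists (derive1 f a - xi); first by rewrite subr_gt0.
  by move=> y w xiy /wE ->; rewrite /secant eqxx; lra.
have {}altb : a < b by rewrite lt_neqAle altb.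
have [V E] := envelope_slope_ex Cf altb cab.
exists V; split.
- by move=> ca; lra.
- by move=> bc; lra.
- move=> _ _; exists (convex_envelope f a b).
    exact: convex_envelope_is_envelope.
  exact: envelope_slope_derive.
- by move=> h; rewrite h ltxx in altb.
- by split => xi h; [exact: (secant_upper Cf cab E)|exact: (secant_lower Cf cab E)].
Qed.

Lemma secant_bounded f (a b c : R) : C1 f -> exists K : R, forall v, a <= v <= b ->
  `|secant f v c| <= K.
Proof.
move=> Cf; have [L L0 HL] := C1_lipschitz (`|a| + `|b| + `|c|) Cf.
exists (L + `|derive1 f c|) => v /andP[av vb].
rewrite /secant; have [_|vc] := eqVneq v c; first by rewrite lerDr.
rewrite -[leLHS]addr0 lerD// normrM normfV ler_pdivrMr ?normr_gt0 ?subr_eq0//.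
have := ler_norm b; have := ler_norm (- a); have := ler_norm c; have := ler_norm (- c).
rewrite !normrN; have := normr_ge0 a; have := normr_ge0 b; have := normr_ge0 c.
by move=> *; apply: HL; lra.
Qed.

Lemma profile_filippov f (a b c V : R) u : C1 f ->
  {ae (mu \x mu)%E, forall p : R * R, 0 < p.2 -> slope_minimizer f a b (p.1 / p.2) (u p)} ->
  secant_separated f a b c V ->
  filippov_solution (fun p => secant f (u p) c) 0 0 (fun t => V * t) /\
  forall x, filippov_solution (fun p => secant f (u p) c) 0 0 x ->
    forall t, 0 <= t -> x t = V * t.
Proof.
move=> Cf Hu [Hup Hlow].
have [K HK] := secant_bounded a b c Cf.
have sec : {ae mu, forall t : R, 0 < t -> {ae mu, forall y,
    slope_minimizer f a b (y / t) (u (y, t))}}.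
  apply: ae_imp (ae_ysection Hu) => t H t0.
  by apply: ae_imp H => y /(_ t0).
have H1 : {ae mu, forall t : R, 0 < t -> {ae mu, forall y, `|secant f (u (y, t)) c| <= K}}.
  apply: ae_imp sec => t H t0; apply: ae_imp (H t0) => y [/HK] //.
have H2 xi : V < xi -> exists2 kap : R, 0 < kap &
  {ae mu, forall t : R, 0 < t ->
    {ae mu, forall y, xi < y / t -> secant f (u (y, t)) c <= y / t - kap}}.
  move=> /Hup[kap kap0 H]; exists kap => //.
  apply: ae_imp sec => t Ht t0; apply: ae_imp (Ht t0) => y Hy xy.
  exact: (H _ _ xy Hy).
have H3 xi : xi < V -> exists2 kap : R, 0 < kap &
  {ae mu, forall t : R, 0 < t ->
    {ae mu, forall y, y / t < xi -> y / t + kap <= secant f (u (y, t)) c}}.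
  move=> /Hlow[kap kap0 H]; exists kap => //.
  apply: ae_imp sec => t Ht t0; apply: ae_imp (Ht t0) => y Hy xy.
  exact: (H _ _ xy Hy).
split; first exact: (filippov_ray (a := fun p => secant f (u p) c) H2 H3).
exact: (filippov_ray_unique (a := fun p => secant f (u p) c) H1 H2 H3).
Qed.

Lemma riemann_bounds f (u0 : R -> R) u (uL uR : R) : C1 f ->
  (forall x, x < 0 -> u0 x = uL) -> (forall x, 0 < x -> u0 x = uR) ->
  entropy_solution f u0 u ->
  {ae (mu \x mu)%E, forall p : R * R, 0 <= p.2 -> Num.min uL uR <= u p <= Num.max uL uR}.
Proof.
move=> Cf uLE uRE [[[mu_ [M uM]] _] ent].
apply: (max_principle Cf mu_ ent uM) => x x0.
have [xn|xp|xE] := ltgtP x 0; last by rewrite xE eqxx in x0.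
  by rewrite uLE// ge_min lexx le_max lexx.
by rewrite uRE// ge_min lexx orbT le_max lexx orbT.
Qed.

(** The order of the data supplies the initial conditions of the two comparisons: [u0 = uR >= k] on
    the right of the origin and [u0 = uL <= k] on the left. Minimality of [k] supplies both chord
    conditions. *)
Lemma rarefaction_profile f (u0 : R -> R) u (uL uR : R) : C1 f -> uL <= uR ->
  (forall x, x < 0 -> u0 x = uL) -> (forall x, 0 < x -> u0 x = uR) ->
  entropy_solution f u0 u ->
  {ae (mu \x mu)%E, forall p : R * R, 0 < p.2 -> slope_minimizer f uL uR (p.1 / p.2) (u p)}.
Proof.
move=> Cf LR uLE uRE Eu; have ub := riemann_bounds Cf uLE uRE Eu.
case: (Eu) => [[[mu_ _] _] ent].
rewrite min_l// max_r// in ub.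
apply: ae_slope_minimizer => // s k [/andP[Lk kR] Hk].
have A : {ae (mu \x mu)%E, forall p : R * R, 0 <= p.2 ->
    0 < 1 * (p.1 - 0 - s * p.2) -> k <= u p}.
  apply: (comparison_below Cf mu_ ent (or_introl erefl) ub).
    by move=> x _; rewrite mul1r subr0 => /uRE ->.
  by move=> v vLR vk; have := Hk v vLR; lra.
have B : {ae (mu \x mu)%E, forall p : R * R, 0 <= p.2 ->
    0 < -1 * (p.1 - 0 - s * p.2) -> u p <= k}.
  apply: (comparison_above Cf mu_ ent (or_intror erefl) ub).
    by move=> x _; rewrite subr0 mulN1r oppr_gt0 => /uLE ->.
  by move=> v vLR vk; have := Hk v vLR; lra.
apply: ae_imp (ae_and A B) => p [HA HB] p0.
by split=> h; [apply: HA|apply: HB] => //; lra.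
Qed.

(* If [u] solves the equation with flux [f] then [- u] solves it with the dual flux;
   the secant slopes are unchanged while convex and concave envelopes, and the
   order of the Riemann data, are exchanged. *)
Definition dual_flux f : R -> R := fun v => - f (- v).

Lemma derive1_dual_flux f v : C1 f ->
  derivable (dual_flux f) v 1 /\ derive1 (dual_flux f) v = derive1 f (- v).
Proof.
move=> Cf; have dN : is_derive v 1 (fun w : R => - w) (-1).
  exact: (is_deriveN (is_derive_id v 1)).
have dC := @is_derive1_comp _ f (fun w => - w) v _ _ (C1_is_derive (- v) Cf) dN.
have [h1 h2] := is_deriveN dC.
by split; [exact: h1|rewrite derive1E; apply: etrans h2 _; rewrite mulrN1 opprK].
Qed.

Lemma C1_dual_flux f : C1 f -> C1 (dual_flux f).
Proof.
move=> Cf; split=> [v|]; first by have [] := derive1_dual_flux v Cf.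
have -> : derive1 (dual_flux f) = fun v => derive1 f (- v).
  by apply/funext => v; have [] := derive1_dual_flux v Cf.
move=> v; apply: (@continuous_comp _ _ _ (fun w : R => - w) (derive1 f)).
  exact: opp_continuous.
exact: Cf.2.
Qed.

Lemma secant_dual_flux f v c : C1 f -> secant (dual_flux f) (- v) (- c) = secant f v c.
Proof.
move=> Cf; rewrite /secant eqr_opp; case: ifP => _.
  by have [_ ->] := derive1_dual_flux (- c) Cf; rewrite opprK.
by rewrite /dual_flux !opprK [RHS]slope_opp; congr (_ / _); ring.
Qed.

(** The comparisons are applied to [u] and [f], and only their conclusions are negated, so the
    equation with the dual flux is never considered. *)
Lemma shock_profile f (u0 : R -> R) u (uL uR : R) : C1 f -> uR <= uL ->
  (forall x, x < 0 -> u0 x = uL) -> (forall x, 0 < x -> u0 x = uR) ->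
  entropy_solution f u0 u ->
  {ae (mu \x mu)%E, forall p : R * R, 0 < p.2 ->
    slope_minimizer (dual_flux f) (- uL) (- uR) (p.1 / p.2) (- u p)}.
Proof.
move=> Cf RL uLE uRE Eu; have ub := riemann_bounds Cf uLE uRE Eu.
case: (Eu) => [[[mu_ _] _] ent].
rewrite min_r// max_l// in ub.
apply: (@ae_slope_minimizer _ (dual_flux f) (- uL) (- uR) (fun p => - u p)).
- exact: C1_dual_flux.
- by rewrite lerN2.
- by apply: ae_imp ub => p H /H; rewrite !lerN2 andbC.
move=> s k [/andP[Lk kR] Hk].
have {}Hk v : uR <= v <= uL -> s * (- v - k) <= f (- k) - f v.
  by move=> vRL; have := Hk (- v); rewrite /dual_flux opprK !lerN2 andbC => /(_ vRL); lra.
have A : {ae (mu \x mu)%E, forall p : R * R, 0 <= p.2 ->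
    0 < 1 * (p.1 - 0 - s * p.2) -> u p <= - k}.
  apply: (comparison_above Cf mu_ ent (or_introl erefl) ub).
    by move=> x _; rewrite mul1r subr0 => /uRE ->; lra.
  by move=> v vLR vk; have := Hk v vLR; lra.
have B : {ae (mu \x mu)%E, forall p : R * R, 0 <= p.2 ->
    0 < -1 * (p.1 - 0 - s * p.2) -> - k <= u p}.
  apply: (comparison_below Cf mu_ ent (or_intror erefl) ub).
    by move=> x _; rewrite subr0 mulN1r oppr_gt0 => /uLE ->; lra.
  by move=> v vLR vk; have := Hk v vLR; lra.
apply: ae_imp (ae_and A B) => p [HA HB] p0.
split=> h; first by rewrite lerNr; apply: HA => //; lra.
by rewrite lerNl; apply: HB => //; lra.
Qed.

Lemma convex_function_point (h : R -> R) (d : R) : convex_function (`[d, d]%classic : set R) h.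
Proof.
apply/convex_functionP => t x y _ _; rewrite /= !in_itv/= => xd yd.
have -> : x = d by lra. have -> : y = d by lra.
have -> : t * d + (1 - t) * d = d by ring.
by rewrite le_eqVlt; apply/orP; left; apply/eqP; ring.
Qed.

Lemma slopes_dual_flux f (c a b : R) :
  slopes (dual_flux f) (- c) (- b) (- a) = slopes f c a b.
Proof.
have E v : (dual_flux f (- v) - dual_flux f (- c)) / (- v - - c) = (f v - f c) / (v - c).
  by rewrite /dual_flux !opprK [RHS]slope_opp; congr (_ / _); ring.
apply/seteqP; split => r [v]; rewrite /= in_itv/= => /andP[h1 h2] <-.
  exists (- v); first by rewrite /= in_itv/=; lra.
  by rewrite -E opprK.
exists (- v); first by rewrite /= in_itv/= !lerN2 h1 h2.
exact: E.
Qed.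

Lemma slopes_point f (c d V : R) : slopes f c d d V -> V = (f d - f c) / (d - c).
Proof.
move=> [v]; rewrite /= in_itv/= => /andP[h1 h2] <-.
by have -> : v = d by lra.
Qed.

(** Reconciles the overlapping [min] and [max] branches of [is_velocity] when the data coincide. *)
Lemma is_min_slopes_point f (c d V : R) :
  is_min (slopes f c d d) V <-> is_max (slopes f c d d) V.
Proof.
by split=> -[sV _]; split => // _ /slopes_point ->; rewrite (slopes_point sV).
Qed.

Lemma convex_envelope_point f (d : R) : is_convex_envelope f d d f.
Proof.
move=> v vd; split; last by move=> r [h [_ hf] <-]; exact: hf.
by exists f => //; split; [exact: convex_function_point|].
Qed.

Lemma concave_envelope_point f (d : R) : is_concave_envelope f d d f.
Proof.
move=> v vd; split; last by move=> r [h [_ hf] <-]; exact: hf.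
by exists f => //; split; [exact: convex_function_point|].
Qed.

Lemma convex_function_reflect (a b : R) (h : R -> R) :
  convex_function (`[a, b]%classic : set R) h ->
  convex_function (`[- b, - a]%classic : set R) (fun w => h (- w)).
Proof.
move=> /convex_functionP ch; apply/convex_functionP => t x y t0 t1.
rewrite /= !in_itv/= => xab yab.
have -> : - (t * x + (1 - t) * y) = t * - x + (1 - t) * - y by ring.
by apply: ch => //; rewrite /= in_itv/=; lra.
Qed.

Lemma concave_envelope_dual f g (a b : R) :
  is_convex_envelope (dual_flux f) (- b) (- a) g ->
  is_concave_envelope f a b (fun v => - g (- v)).
Proof.
move=> H v; rewrite in_itv/= => vab.
have [|[h [ch hf] hg] ub] := H (- v); first by rewrite in_itv/= !lerN2 andbC.
split.
  exists (fun w => - h (- w)); last by rewrite hg.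
  split.
    have := convex_function_reflect ch; rewrite !opprK.
    by congr (convex_function _ _); apply/funext => w; rewrite opprK.
  move=> w; rewrite in_itv/= => wab; have := hf (- w).
  by rewrite in_itv/= !lerN2 andbC /dual_flux opprK => /(_ wab); lra.
move=> r [k [ck fk] <-]; rewrite lerNl; apply: ub.
exists (fun w => - k (- w)); last by rewrite opprK.
split; first by have := convex_function_reflect ck.
move=> w; rewrite in_itv/= => wab; rewrite /dual_flux lerN2; apply: fk.
by rewrite in_itv/=; lra.
Qed.

Lemma envelope_derive_dual f g (a b c V : R) : a < b ->
  is_envelope_derive (dual_flux f) g (- b) (- a) (- c) V ->
  is_envelope_derive f (fun v => - g (- v)) a b c V.
Proof.
move=> ab; rewrite /is_envelope_derive eqr_opp (gt_eqF ab) (lt_eqF ab).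
move=> H; apply/cvgrPdist_le => e e0; move/cvgrPdist_le/(_ e e0): H.
rewrite !near_withinE => /nbhs_ballP[d /= d0 H].
apply/nbhs_ballP; exists d => //= w wd wc wab.
have -> : (- g (- w) - - g (- c)) / (w - c) = (g (- w) - g (- c)) / (- w - - c).
  by rewrite [RHS]slope_opp; congr (_ / _); ring.
apply: (H (- w)).
- by move: wd; rewrite /ball/= distrC; congr (_ < _); congr (`|_|); ring.
- by rewrite eqr_opp.
- by move: wab; rewrite !in_itv/= !lerN2 andbC.
Qed.

End assembly.

Theorem theorem1p6 (R : realType) (f : R -> R) (uL uR : R) (u0 : R -> R)
    (u : R * R -> R) (c : R) :
  C1 f ->
  (forall x, x < 0 -> u0 x = uL) -> (forall x, 0 < x -> u0 x = uR) ->
  entropy_solution f u0 u ->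
  let a_c := fun p : R * R => secant f (u p) c in
  exists V : R,
    [/\ is_velocity f c uL uR V,
        filippov_solution a_c 0 0 (fun t => V * t) &
        forall x : R -> R, filippov_solution a_c 0 0 x ->
          forall t, 0 <= t -> x t = V * t].
Proof.
move=> Cf uLE uRE Eu a_c.
have [LR|RL] : uL <= uR \/ uR < uL by case: leP; [left|right].
  have [V [vmin vmax venv vpt sep]] := velocity_ex c Cf LR.
  have [fil uniq] := profile_filippov Cf (rarefaction_profile Cf LR uLE uRE Eu) sep.
  exists V; split => //.
  (* The branches written for [uR <= uL] survive in this case only for equal data. *)
  have pt : uR <= uL -> uL = uR by move=> RL; lra.
  split=> //.
  - by move=> cL _; exact: vmin.
  - move=> cR /pt E; rewrite E in vmin *; apply/(is_min_slopes_point f c uR V).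
    by apply: vmin.
  - move=> Lc cR; have [E|nE] := eqVneq uL uR.
      exists f; first by rewrite E; exact: convex_envelope_point.
      by rewrite /is_envelope_derive E eqxx; apply: vpt => //; lra.
    by apply: venv; [rewrite lt_neqAle nE|rewrite Lc].
  - move=> Rc cL; have E : uL = uR by apply: pt; lra.
    exists f; first by rewrite E; exact: concave_envelope_point.
    by rewrite /is_envelope_derive E eqxx; apply: vpt => //; lra.
  - split=> [_ |/pt E Lc]; first exact: vmax.
    by rewrite E in vmax Lc *; apply/is_min_slopes_point; apply: vmax.
have Cd := C1_dual_flux Cf.
have NLR : - uL <= - uR by rewrite lerN2 ltW.
have [V [vmin vmax venv vpt sep]] := velocity_ex (- c) Cd NLR.
have [] := profile_filippov Cd (shock_profile Cf (ltW RL) uLE uRE Eu) sep.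
(* Reflection of the state leaves the field itself unchanged, so both Filippov statements transfer
   verbatim. *)
have -> : (fun p => secant (dual_flux f) (- u p) (- c)) = a_c.
  by apply/funext => p; rewrite secant_dual_flux.
move=> fil uniq; exists V; split => //.
rewrite !slopes_dual_flux in vmin vmax.
split.
- by move=> _ LR; lra.
- by move=> cR _; apply: vmax; rewrite ltrN2.
- by move=> Lc cR; lra.
- move=> Rc cL; have [||g gc gd] := venv; first by rewrite ltrN2.
    by rewrite !lerN2 Rc cL.
  exists (fun v => - g (- v)); first exact: concave_envelope_dual.
  exact: envelope_derive_dual.
- by split=> [LR|_ Lc]; [lra|apply: vmin; rewrite ltrN2].
Qed.
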